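(* Let $d\ge2$, let $(\mathcal T,o)$ be a unimodular random rooted tree of degree bounded by $d$, and let $\mathcal T'=\mathrm{spine}(\mathcal T)$ be its spine. Then: (i) if $\mathcal T'$ is almost surely a non-empty regular tree, then $\overline{\mathrm{gr}}(\mathcal T)=\overline{\mathrm{gr}}(\mathcal T')$ almost surely; (ii) in general, $\overline{\mathrm{gr}}(\mathcal T)\le\max\{(d-1)^{1/2},\overline{\mathrm{gr}}(\mathcal T')\}$ almost surely; (iii) in particular, if $\overline{\mathrm{gr}}(\mathcal T)>(d-1)^{1/2}$ almost surely, then $\overline{\mathrm{gr}}(\mathcal T)=\overline{\mathrm{gr}}(\mathcal T')$ almost surely.
   Context: For a connected graph $G$ of bounded degree, $\overline{\mathrm{gr}}(G)=\limsup_{n\to\infty}|B_G(o,n)|^{1/n}$, where $B_G(o,n)$ is the set of vertices at graph distance at most $n$ from the vertex $o$; this does not depend on $o$. For the empty graph set $\overline{\mathrm{gr}}=0$. An edge $e$ of a tree $T$ is weak if one of the sides of $T\setminus e$ is finite; $\mathrm{spine}(T)$ is the unique infinite connected component of what remains of $T$ after removing all weak edges, and is empty if there is no such component. A random rooted graph $(G,o)$ of degrees bounded by $d$ is a random element of the space of isomorphism classes of connected rooted graphs with degrees at most $d$ (with the local topology, given by isomorphism of balls around the root). It is unimodular if it satisfies the Mass Transport Principle: for every measurable non-negative function $F$ on (isomorphism classes of) triples $(G,x,y)$, with $G$ a bounded degree connected graph and $x,y\in V(G)$, one has $\mathbb E(\sum_{x\in V(G)}F(G,o,x))=\mathbb E(\sum_{x\in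 V(G)}F(G,x,o))$, provided one of the sides is finite. A unimodular random rooted tree is a unimodular random rooted graph that is almost surely a tree. *)

(* Defs.v *)
From HB Require Import structures.
From mathcomp Require Import all_boot all_order all_algebra generic_quotient.
From mathcomp Require Import finmap.
From mathcomp Require Import all_classical all_reals all_analysis.

Set Implicit Arguments.
Unset Strict Implicit.
Unset Printing Implicit Defensive.

Import Order.TTheory GRing.Theory Num.Theory.
Import numFieldNormedType.Exports.

Local Open Scope classical_set_scope.
Local Open Scope card_scope.
Local Open Scope quotient_scope.
Local Open Scope ring_scope.

(* Simple graphs whose vertices are natural numbers; the vertex set may be
   empty, finite or infinite. Connected graphs of bounded degree are countable,
   so every isomorphism class of such graphs has a representative here. *)
Record graph := Graph {
  vert : set nat;
  adj : rel nat;
  adj_sym : symmetric adj;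
  adj_irrefl : irreflexive adj;
  adj_vert : forall x y, adj x y -> vert x }.

Definition vertex (G : graph) := set_type (vert G).

Section Graphs.
Implicit Types (G : graph) (x y o : nat) (A : set nat).

Definition component G x : set nat :=
  [set y | exists2 s, path (adj G) x s & last x s = y].

Definition connected_graph G :=
  forall x y, vert G x -> vert G y -> component G x y.

Definition degree_le (d : nat) G :=
  forall x, vert G x -> [set y | adj G x y] #<= `I_d.

Definition regular_graph G :=
  exists k : nat, forall x, vert G x -> [set y | adj G x y] #= `I_k.

Definition is_tree G :=
  connected_graph G /\
  forall c : seq nat, cycle (adj G) c -> uniq c -> (size c < 3)%N.

Definition gball G o (n : nat) : set nat :=
  [set y | exists s, [/\ path (adj G) o s, last o s = y & (size s <= n)%N]].

Lemma induced_sym G A :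
  symmetric (fun x y => [&& adj G x y, `[< A x >] & `[< A y >]]).
Proof. by move=> x y; rewrite adj_sym; congr andb; rewrite andbC. Qed.

Lemma induced_irrefl G A :
  irreflexive (fun x y => [&& adj G x y, `[< A x >] & `[< A y >]]).
Proof. by move=> x; rewrite adj_irrefl. Qed.

Lemma induced_vert G A x y :
  [&& adj G x y, `[< A x >] & `[< A y >]] -> (vert G `&` A) x.
Proof. by move=> /and3P[/adj_vert Gx /asboolP Ax _]; split. Qed.

Definition induced G A :=
  Graph (@induced_sym G A) (@induced_irrefl G A) (@induced_vert G A).

Section RemoveEdges.
Variables (G : graph) (W : nat -> nat -> Prop).

Let radj : rel nat := fun x y => adj G x y && ~~ `[< W x y \/ W y x >].

Lemma remove_edges_sym : symmetric radj.
Proof.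
by move=> x y; rewrite /radj adj_sym; congr (_ && ~~ _); apply: asbool_equiv_eq;
  split=> -[]; by [left|right].
Qed.

Lemma remove_edges_irrefl : irreflexive radj.
Proof. by move=> x; rewrite /radj adj_irrefl. Qed.

Lemma remove_edges_vert x y : radj x y -> vert G x.
Proof. by move=> /andP[/adj_vert]. Qed.

Definition remove_edges :=
  Graph remove_edges_sym remove_edges_irrefl remove_edges_vert.

End RemoveEdges.

Definition del_edge G x y := remove_edges G (fun u v => u = x /\ v = y).

Definition weak_edge G x y :=
  adj G x y /\ (finite_set (component (del_edge G x y) x) \/
                finite_set (component (del_edge G x y) y)).

Definition strong_part G := remove_edges G (weak_edge G).

(* The subgraph of [strong_part G] formed by its infinite component: when [G] is
   connected there is at most one (lemma [infinite_component_unique]). *)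
Definition spine G :=
  induced (strong_part G)
    [set x | infinite_set (component (strong_part G) x)].

Lemma component_trans G y x z :
  component G x y -> component G y z -> component G x z.
Proof.
move=> [s ps <-] [t pt <-]; exists (s ++ t); first by rewrite cat_path ps.
by rewrite last_cat.
Qed.

Lemma component_sym G x y : component G x y -> component G y x.
Proof.
move=> [s ps <-]; exists (rev (belast x s)).
  by rewrite rev_path (eq_path (e' := adj G)) // => u v; rewrite adj_sym.
by case: s {ps} => //= a s; rewrite rev_cons last_rcons.
Qed.

Lemma path_del_edge G u v w x (s : seq nat) : w = u \/ w = v ->
  w \notin x :: s -> path (adj G) x s -> path (adj (del_edge G u v)) x s.
Proof.
move=> wuv; elim: s x => //= a s IHs x; rewrite inE negb_or => /andP[wx was].
move=> /andP[xa ps]; rewrite xa IHs // andbT /=; apply/asboolPn.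
move: was; rewrite inE negb_or => /andP[wa _] xauv.
by move: wuv wx wa; case: xauv => -[-> ->] [] ->; rewrite eqxx ?andbF.
Qed.

Lemma component_del_edgeC G u v :
  component (del_edge G u v) = component (del_edge G v u).
Proof.
apply/funext => z; rewrite /component.
congr (fun e => [set y | exists2 s, path e z s & last z s = y]).
apply/funext => a; apply/funext => b /=; congr (_ && ~~ _).
by apply: asbool_equiv_eq; tauto.
Qed.

Lemma infinite_component_unique G x y : connected_graph G ->
  vert G x -> vert G y ->
  infinite_set (component (strong_part G) x) ->
  infinite_set (component (strong_part G) y) ->
  component (strong_part G) x y.
Proof.
move=> Gconn Gx Gy xoo yoo; have [s ps sy] := Gconn _ _ Gx Gy; subst y; clear Gy.
case: (shortenP ps) yoo => {}s {}ps us _ yoo; exists s => //.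
apply/(pathP 0%N) => i si; have /(pathP 0%N)/(_ i si) := ps.
set u := nth _ (x :: s) i; set v := nth _ s i => uv.
have split_s : s = take i s ++ v :: drop i.+1 s.
  by rewrite -drop_nth // cat_take_drop.
have last_u : last x (take i s) = u.
  rewrite /u; case: i si {uv u v split_s} => [|i] si; first by rewrite take0.
  by rewrite (take_nth 0%N) ?last_rcons // ltnW.
have split_xs : x :: s = (x :: take i s) ++ v :: drop i.+1 s.
  by rewrite cat_cons -split_s.
have ux : u \in x :: take i s by rewrite -last_u mem_last.
move: ps; rewrite [X in path _ x X]split_s cat_path /= last_u.
move=> /and3P[ps1 _ ps2].
move: us; rewrite split_xs cat_uniq => /and3P[_ /hasPn disj _].
have vx : v \notin x :: take i s by rewrite (disj v) // mem_head.
have uv2 : u \notin v :: drop i.+1 s by apply: contraL ux => /disj.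
have {}yoo : infinite_set (component (strong_part G) (last v (drop i.+1 s))).
  by move: yoo; rewrite [X in last x X]split_s last_cat last_cons.
rewrite /= uv /=; apply/asboolPn => uvweak.
have {}uvweak : weak_edge G u v.
  by case: uvweak => // -[vu []]; rewrite -(component_del_edgeC G u v) => wk;
    split=> //; [right|left].
have strong_sub z :
    component (strong_part G) z `<=` component (del_edge G u v) z.
  move=> t [p pp <-]; exists p => //; apply: sub_path pp => a b /= /andP[-> ab].
  rewrite /=; apply: contraNN ab => /asboolP ab; apply/asboolP.
  by case: ab => -[-> ->]; [left|right].
have sub_u : component (strong_part G) x `<=` component (del_edge G u v) u.
  move=> t /strong_sub; apply: component_trans; apply: component_sym.
  exists (take i s) => //.
  by apply: path_del_edge vx ps1; right.
have sub_v : component (strong_part G) (last v (drop i.+1 s)) `<=`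
    component (del_edge G u v) v.
  move=> t /strong_sub; apply: component_trans; exists (drop i.+1 s) => //.
  by apply: path_del_edge uv2 ps2; left.
by case: uvweak => _ [] fin; [apply: xoo|apply: yoo]; apply: sub_finite_set fin.
Qed.

End Graphs.

Section Growth.
Variable R : realType.
Local Open Scope ereal_scope.

Definition growth_at (G : graph) (o : nat) : \bar R :=
  limn_esup (fun n =>
    ((#|` fset_set (gball G o n)|%:R : R) `^ (n%:R^-1))%R%:E).

(* For a connected graph of bounded degree, [growth_at] does not depend on the
   vertex, so the choice made here is immaterial. *)
Definition growth (G : graph) : \bar R :=
  if pselect (exists o, vert G o) is left h then growth_at G (projT1 (cid h))
  else 0.

End Growth.

(* Connected graphs of degree at most [d] with [k] marked vertices: [k = 1] for
   rooted graphs (G, o), [k = 2] for triples (G, x, y). *)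
Record marked_graph (d k : nat) := MarkedGraph {
  base_graph :> graph;
  base_connected : connected_graph base_graph;
  base_degree : degree_le d base_graph;
  marks : k.-tuple (vertex base_graph) }.

HB.instance Definition _ d k := gen_eqMixin (marked_graph d k).
HB.instance Definition _ d k := gen_choiceMixin (marked_graph d k).

Section OneVertex.

Let adj0 : rel nat := fun _ _ => false.

Let adj0_vert x y : adj0 x y -> [set 0%N] x. Proof. by []. Qed.

Definition one_vertex : graph :=
  @Graph [set 0%N] adj0 (fun _ _ => erefl) (fun _ => erefl) adj0_vert.

Lemma one_vertex_connected : connected_graph one_vertex.
Proof. by move=> x y -> ->; exists [::]. Qed.

Lemma one_vertex_degree d : degree_le d one_vertex.
Proof.
move=> x _; rewrite (_ : [set y | _] = set0) ?card_ge0//.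
by rewrite -subset0 => y.
Qed.

Lemma one_vertex_vert : 0%N \in vert one_vertex. Proof. by rewrite inE. Qed.

Definition one_vertex_marked d k : marked_graph d k :=
  MarkedGraph one_vertex_connected (@one_vertex_degree d)
    (nseq_tuple k (SigSub one_vertex_vert : vertex one_vertex)).

End OneVertex.

Section Isomorphism.
Variables d k : nat.
Implicit Types G H K : marked_graph d k.

Definition mark_seq G : seq nat := [seq val x | x <- marks G].

(* The subgraphs induced by [G] on [A] and by [H] on [B] are isomorphic, with
   the marks of [G] sent in order to those of [H]. *)
Definition iso_on (A B : set nat) G H := exists f : nat -> nat,
  [/\ set_bij A B f,
      forall x y, A x -> A y -> adj H (f x) (f y) = adj G x y
    & map f (mark_seq G) = mark_seq H].

Definition iso G H := iso_on (vert G) (vert H) G H.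

(* The union of the balls around all marks; the mutual distance of the marks
   being finite, balls around one of them would give the same topology. *)
Definition marks_ball G (n : nat) : set nat :=
  [set y | exists2 x, x \in mark_seq G & gball G x n y].

Definition ball_iso (n : nat) G H :=
  iso_on (marks_ball G n) (marks_ball H n) G H.

Lemma mark_seq_vert G x : x \in mark_seq G -> vert G x.
Proof. by move=> /mapP[y _ ->]; exact: set_valP. Qed.

Lemma iso_refl : reflexive (fun G H => `[< iso G H >]).
Proof.
move=> G; apply/asboolP; exists id; split=> //; last by rewrite map_id.
by split=> [x //|x y _ _ //|x Gx]; exists x.
Qed.

Lemma iso_symP G H : iso G H -> iso H G.
Proof.
move=> [f [[fV finj fsurj] fadj fm]].
have /boolp.choice[g gP] y : exists x, vert H y -> vert G x /\ f x = y.
  have [Hy|nHy] := pselect (vert H y); last by exists 0%N.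
  by have [x Gx fx] := fsurj _ Hy; exists x.
have gK x : vert G x -> g (f x) = x.
  move=> Gx; have [Ggx fgx] := gP _ (fV _ Gx).
  by apply: finj => //; rewrite inE.
exists g; split.
- split=> [y Hy|x y|x Gx].
  + by have [] := gP _ Hy.
  + rewrite !inE => Hx Hy gxy.
    by have [_ <-] := gP _ Hx; rewrite gxy; have [_ ->] := gP _ Hy.
  + by exists (f x); [exact: fV|exact: gK].
- move=> x y Hx Hy; have [Gx fx] := gP _ Hx; have [Gy fy] := gP _ Hy.
  by rewrite -{2}fx -{2}fy fadj.
- rewrite -fm -map_comp -[RHS]map_id; apply/eq_in_map => x xG /=.
  exact/gK/mark_seq_vert.
Qed.

Lemma iso_sym : symmetric (fun G H => `[< iso G H >]).
Proof.
by move=> G H; apply: asbool_equiv_eq; split; apply: iso_symP.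
Qed.

Lemma iso_trans : transitive (fun G H => `[< iso G H >]).
Proof.
move=> H G K /asboolP[f [fb fadj fm]] /asboolP[g [gb gadj gm]].
apply/asboolP; exists (g \o f); split; last by rewrite map_comp fm.
- exact: set_bij_comp fb gb.
- by case: fb => fV _ _ x y Gx Gy /=; rewrite gadj ?fadj //; exact: fV.
Qed.

Definition iso_equiv := EquivRel _ iso_refl iso_sym iso_trans.

Definition iso_class := {eq_quot iso_equiv}.

HB.instance Definition _ := EqQuotient.on iso_class.
HB.instance Definition _ := Choice.on iso_class.
HB.instance Definition _ :=
  isPointed.Build iso_class (\pi_iso_class (one_vertex_marked d k)).

Lemma gball_rcons (G : graph) o n x y :
  gball G o n x -> adj G x y -> gball G o n.+1 y.
Proof.
move=> [s [ps <- sn]] xy; exists (rcons s y).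
by rewrite rcons_path ps last_rcons size_rcons.
Qed.

Lemma gball_le (G : graph) o n m : (n <= m)%N -> gball G o n `<=` gball G o m.
Proof. by move=> nm y [s [? ? sn]]; exists s; split=> //; exact: leq_trans nm. Qed.

Lemma marks_ball_le G n m : (n <= m)%N -> marks_ball G n `<=` marks_ball G m.
Proof. by move=> nm y [x xG xy]; exists x => //; exact: gball_le xy. Qed.

Lemma ball_iso_le n m G H : (n <= m)%N -> ball_iso m G H -> ball_iso n G H.
Proof.
move=> nm [f [[fV finj fsurj] fadj fm]].
have inm x y l : (l <= m)%N -> x \in mark_seq G -> gball G x l y ->
    marks_ball G m y.
  by move=> lm xG xy; exists x => //; exact: gball_le xy.
have fmark x : x \in mark_seq G -> f x \in mark_seq H.
  by rewrite -fm => xG; apply: map_f.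
have fball x l y : (l <= m)%N -> x \in mark_seq G -> gball G x l y ->
    gball H (f x) l (f y).
  move=> + xG; elim: l y => [|l IHl] y lm.
    by case=> -[|a s] [] // _ <- _; exists [::].
  move=> [s]; case/lastP: s => [[_ <- _]|s z [+ + +]]; first by exists [::].
  rewrite rcons_path last_rcons size_rcons => /andP[ps zs] <- sl.
  have xl : gball G x l (last x s) by exists s.
  apply: gball_rcons (IHl _ (ltnW lm) xl) _.
  rewrite fadj //; last exact: inm lm xG (gball_rcons xl zs).
  exact: inm (ltnW lm) xG xl.
have fballV x l y : (l <= m)%N -> x \in mark_seq G -> gball H (f x) l y ->
    exists2 z, gball G x l z & f z = y.
  move=> + xG; elim: l y => [|l IHl] y lm.
    by case=> -[|a s] [] // _ <- _; exists x => //; exists [::].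
  move=> [s]; case/lastP: s => [[_ <- _]|s z [+ + +]].
    by exists x => //; exists [::].
  rewrite rcons_path last_rcons size_rcons => /andP[ps zs] <- sl.
  have xl : gball H (f x) l (last (f x) s) by exists s.
  have [u xu fu] := IHl _ (ltnW lm) xl.
  have : marks_ball H m z.
    by exists (f x); [exact: fmark|apply: gball_le lm _ _; apply: gball_rcons zs].
  move=> /fsurj[v vm fv]; exists v => //.
  apply: (gball_rcons xu).
  by rewrite -fadj // ?fu ?fv //; exact: inm (ltnW lm) xG xu.
exists f; split=> //; last first.
  by move=> x y Gx Gy; rewrite fadj //; [exact: marks_ball_le Gx|
    exact: marks_ball_le Gy].
split.
- by move=> y [x xG xy]; exists (f x); [exact: fmark|exact: fball].
- move=> x y; rewrite !inE => Gx Gy; apply: finj; rewrite inE;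
    by [exact: marks_ball_le Gx|exact: marks_ball_le Gy].
- move=> y [x']; rewrite -fm => /mapP[x xG ->] xy.
  by have [z xz <-] := fballV _ _ _ nm xG xy; exists z => //; exists x.
Qed.

Definition local_open (U : set iso_class) := forall c, U c ->
  exists n, forall c', ball_iso n (repr c) (repr c') -> U c'.

Lemma local_openT : local_open setT.
Proof. by move=> c _; exists 0%N. Qed.

Lemma local_openI : setI_closed local_open.
Proof.
move=> U V oU oV c [/oU[n Un] /oV[m Vm]]; exists (maxn n m) => c' cc'.
split; [apply: Un|apply: Vm]; apply: ball_iso_le cc'.
  exact: leq_maxl.
exact: leq_maxr.
Qed.

Lemma local_open_bigU (I : Type) (f : I -> set iso_class) :
  (forall i, local_open (f i)) -> local_open (\bigcup_i f i).
Proof.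
move=> fo c [i _ /fo[n fn]]; exists n => c' cc'; exists i => //; exact: fn.
Qed.

HB.instance Definition _ := isOpenTopological.Build iso_class
  local_openT local_openI local_open_bigU.

(* [iso_class] with the Borel sigma-algebra of the local topology. *)
Definition borel_class := g_sigma_algebraType (@open iso_class).

End Isomorphism.

Definition rooted_graph (d : nat) := borel_class d 1.
Definition birooted_graph (d : nat) := borel_class d 2.

Definition rep d (c : rooted_graph d) : marked_graph d 1 :=
  repr (c : iso_class d 1).
Coercion rep : rooted_graph >-> marked_graph.

Definition root d (G : marked_graph d 1) : vertex G := thead (marks G).

Definition birooted d (G : marked_graph d 1) (x y : vertex G) :
    birooted_graph d :=
  \pi_(iso_class d 2)
    (MarkedGraph (@base_connected _ _ G) (@base_degree _ _ G) [tuple x; y]).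

Section Unimodular.
Context {R : realType} {d : nat}.
Local Open Scope ereal_scope.

Definition mass_out (F : birooted_graph d -> R) (G : rooted_graph d) : \bar R :=
  \esum_(x in [set: vertex G]) (F (birooted (root G) x))%:E.

Definition mass_in (F : birooted_graph d -> R) (G : rooted_graph d) : \bar R :=
  \esum_(x in [set: vertex G]) (F (birooted x (root G)))%:E.

Definition unimodular disp (Omega : measurableType disp)
    (P : probability Omega R) (X : {RV P >-> rooted_graph d}) : Prop :=
  forall F : birooted_graph d -> R,
    measurable_fun setT F -> (forall t, (0 <= F t)%R) ->
    \int[P]_w mass_out F (X w) < +oo \/ \int[P]_w mass_in F (X w) < +oo ->
    \int[P]_w mass_out F (X w) = \int[P]_w mass_in F (X w).

End Unimodular.

(* Main.v *)
Require Import Defs.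
From mathcomp Require Import all_boot all_order all_algebra.
From mathcomp Require Import finmap all_classical all_reals all_analysis.
From mathcomp Require Import measurable_realfun lra zify.

Set Implicit Arguments.
Unset Strict Implicit.
Unset Printing Implicit Defensive.

Import Order.TTheory GRing.Theory Num.Theory.

Local Open Scope classical_set_scope.
Local Open Scope ring_scope.
Local Open Scope ereal_scope.

(** Write [d x y] for the graph distance, [q] for the degree bound minus one and
    [T'] for the spine. Up to an arbitrarily small change of [s], the growth of
    a graph is at most [1 / s] exactly when the sums of [s ^+ d o y] over the
    vertices [y] are bounded ([growth_at_summable], [growth_at_le]). So growth
    of the tree has to be compared with growth of the spine through the
    finiteness of such exponential sums.

    Probability enters through one transport. Given a relation [S], every vertex
    [x] spreads a unit mass over the [y] with [S x y], proportionally to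
    [s ^+ d x y]. The root sends mass at most one, so by unimodularity it
    receives a mass of mean at most one; hence, almost surely, the sum over the
    [x] with [S x o] of [s ^+ d x o / W x] is finite, where [W x] is the sum of
    [s ^+ d x y] over the [y] with [S x y]. In order to transport only along
    functions of a finite ball, whose measurability is immediate, [S] is
    replaced by relations [Q n] that are visible in a ball and converge to [S]
    on the trees of interest, and targets are taken within a distance [N]; two
    applications of Fatou's lemma recover the limit ([ae_received_liminf],
    [received_bound]).

    If the spine is not empty, take for [S x y] that [y] is within a fixed
    distance of it. Then [W x] is comparable with the sum of [s ^+ d x u] over
    the [u] in [T'] ([spine_received]).

    - If [T'] is a regular tree, the spheres of [T'] have the same size around
      all vertices. Therefore [W] is bounded as soon as [1 / s] exceeds the
      growth of [T'] ([regular_tree_sum]), and the sum of [s ^+ d x o] is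
      finite. This is the first assertion.

    - In general, let [s < t < 1 / sqrt q], and let [w x] be the sum of
      [t ^+ d x u] over [T'], which is finite when [1 / t] exceeds the growth of
      [T']. The transport shows that the sum of [s ^+ d x o / w x] is finite. On
      the other hand, in a tree the sum over [y] of [s ^+ d x y * t ^+ d y u] is
      at most a constant times [t ^+ d x u] ([green_sum]; this is where
      [1 / sqrt q] comes from), so the sum of [s ^+ d x o * w x] is finite too.
      Since [1 <= (w x)^-1 + w x], the sum of [s ^+ d x o] is finite
      ([summable_of_spine]).

    If the tree is infinite with empty spine, all its edges are weak, so the
    distances from two given vertices to a far vertex [z] differ by a constant
    ([eventually_level]). Take for [S x y] that [y] is not farther than [x] from
    such [z]. Here [W] is bounded, by [green_sum] applied with [u] far away, and
    for every [x] one of [S x o] and [S o x] holds: the sum of [s ^+ d x o] over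
    the former [x] is finite by the transport, over the latter it is at most
    [W o] ([summable_of_empty_spine]).

    The third assertion follows from the second, as the growth of the spine
    never exceeds that of the tree ([growth_spine_le]). *)

(** * Balls and graph distance *)

Section Distance.
Implicit Types (G : graph) (x y z : nat).

Lemma adj_vertr G x y : adj G x y -> vert G y.
Proof. by rewrite adj_sym; exact: adj_vert. Qed.

Lemma gball_sym G x n y : gball G x n y -> gball G y n x.
Proof.
move=> [s [ps <- sn]]; exists (rev (belast x s)); split.
- by rewrite rev_path (eq_path (e' := adj G)) // => u v; rewrite adj_sym.
- by case: s {ps sn} => //= a s; rewrite rev_cons last_rcons.
- by rewrite size_rev size_belast.
Qed.

Lemma gball_trans G x y z m n :
  gball G x m y -> gball G y n z -> gball G x (m + n) z.
Proof.
move=> [s [ps <- sm]] [t [pt <- tn]]; exists (s ++ t); split.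
- by rewrite cat_path ps.
- by rewrite last_cat.
- by rewrite size_cat leq_add.
Qed.

Lemma gball_refl G x n : gball G x n x.
Proof. by exists [::]. Qed.

Lemma gball0 G x y : gball G x 0 y -> y = x.
Proof. by move=> [s [_ <-]]; rewrite leqn0 => /nilP ->. Qed.

Lemma gballS G x n y : gball G x n.+1 y ->
  y = x \/ exists2 p, adj G x p & gball G p n y.
Proof.
move=> [[|p s] [/= ps sy sn]]; first by left.
by case/andP: ps => xp ps; right; exists p => //; exists s.
Qed.

Lemma gball_adj G x p : adj G x p -> gball G x 1 p.
Proof. by move=> xp; exists [:: p]; rewrite /= xp. Qed.

Lemma gball_vert G x n y : vert G x -> gball G x n y -> vert G y.
Proof.
move=> Gx [s [+ <- _]]; elim: s x Gx => //= p s IHs x _ /andP[xp].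
exact/IHs/adj_vertr/xp.
Qed.

Definition dist G x y : nat :=
  if pselect (exists n, `[< gball G x n y >]) is left h then ex_minn h else 0%N.

Lemma gball_dist G x n y : gball G x n y ->
  (dist G x y <= n)%N /\ gball G x (dist G x y) y.
Proof.
move=> xny; rewrite /dist; case: pselect => [h|[]].
  by case: ex_minnP => m /asboolP xmy mle; split=> //; exact/mle/asboolP.
by exists n; exact/asboolP.
Qed.

End Distance.

Section ConnectedDistance.
Variable G : graph.
Hypothesis Gconn : connected_graph G.
Implicit Types x y z p : nat.
Local Notation V := (vert G).
Local Notation d := (dist G).

Lemma dist_ball x y n : V x -> V y -> (d x y <= n)%N -> gball G x n y.
Proof.
move=> Vx Vy dn; have [s ps sy] := Gconn Vx Vy.
have /gball_dist[_] : gball G x (size s) y by exists s.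
exact: gball_le.
Qed.

Lemma gball_distW x y n : gball G x n y -> (d x y <= n)%N.
Proof. by case/gball_dist. Qed.

Lemma distC x y : V x -> V y -> d x y = d y x.
Proof.
move=> Vx Vy; apply/eqP; rewrite eqn_leq.
by apply/andP; split; apply/gball_distW/gball_sym/dist_ball.
Qed.

Lemma distD x y z : V x -> V y -> V z -> (d x z <= d x y + d y z)%N.
Proof.
move=> Vx Vy Vz; apply: gball_distW.
by apply: (@gball_trans G x y); exact: dist_ball.
Qed.

Lemma dist0 x y : V x -> V y -> (d x y == 0)%N = (x == y).
Proof.
move=> Vx Vy; apply/idP/eqP => [/eqP xy|->].
  by apply/esym/(@gball0 G)/dist_ball; rewrite ?xy.
by rewrite -leqn0; exact/gball_distW/gball_refl.
Qed.

Lemma distxx x : V x -> d x x = 0%N.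
Proof. by move=> Vx; apply/eqP; rewrite dist0. Qed.

Lemma dist_adj x p y : adj G x p -> V y -> (d x y <= (d p y).+1)%N.
Proof.
move=> xp Vy; have Vx := adj_vert xp; have Vp := adj_vertr xp.
rewrite -add1n; apply: leq_trans (distD Vx Vp Vy) _; rewrite leq_add2r.
exact/gball_distW/gball_adj.
Qed.

Lemma dist_adj1 x p : adj G x p -> d x p = 1%N.
Proof.
move=> xp; have Vx := adj_vert xp; have Vp := adj_vertr xp.
apply/eqP; rewrite eqn_leq lt0n dist0 //; apply/andP; split.
  exact/gball_distW/gball_adj.
by apply: contraTneq xp => ->; rewrite adj_irrefl.
Qed.

Lemma dist_step x y n : V x -> V y -> d x y = n.+1 ->
  exists2 p, adj G x p & d p y = n.
Proof.
move=> Vx Vy xyn.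
have /gballS[yx|[p xp py]] : gball G x n.+1 y by apply: dist_ball; rewrite ?xyn.
  by move: xyn; rewrite yx distxx.
by exists p => //; have := dist_adj xp Vy; have := gball_distW py; lia.
Qed.

(** The vertices of a geodesic are only known through their distance to [y]:
    this is enough to see that two geodesics to [y], glued together, avoid a
    vertex that is farther from [y]. *)
Lemma geodesic x y : V x -> V y ->
  exists s, [/\ path (adj G) x s, last x s = y &
    forall v, v \in s -> V v /\ (d v y < d x y)%N].
Proof.
move=> Vx Vy; move xyn: (d x y) => n; elim: n x Vx xyn => [|n IHn] x Vx xyn.
  by move/eqP: xyn; rewrite dist0 // => /eqP ->; exists [::].
have [p xp py] := dist_step Vx Vy xyn; have Vp := adj_vertr xp.
have [s [ps sy sn]] := IHn _ Vp py; exists (p :: s); split => //=.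
  by rewrite xp.
move=> v; rewrite inE => /predU1P[->|/sn[Vv vn]]; first by rewrite py.
by split=> //; exact: leq_trans vn _.
Qed.

Lemma dist_between x y n : V x -> V y -> (n <= d x y)%N ->
  exists c, [/\ V c, d x c = n & d x y = (n + d c y)%N].
Proof.
move=> Vx Vy; elim: n => [|n IHn] xyn; first by exists x; rewrite distxx.
have [c [Vc xc xcy]] := IHn (ltnW xyn).
have [m cy] : exists m, d c y = m.+1 by case: (d c y) xcy xyn => [|m]; [lia|exists m].
have [p cp py] := dist_step Vc Vy cy; have Vp := adj_vertr cp.
exists p; split => //; last by lia.
have := distD Vx Vp Vy; have := distD Vx Vc Vp; rewrite (dist_adj1 cp); lia.
Qed.

End ConnectedDistance.

(** * Metric structure of trees *)

Section Tree.
Variable G : graph.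
Hypothesis Gtree : is_tree G.
Implicit Types x y z p : nat.
Local Notation V := (vert G).
Local Notation d := (dist G).

Let Gconn : connected_graph G. Proof. by case: Gtree. Qed.

(** Together with [v], such a path would contain a cycle. *)
Lemma tree_no_detour v a b s : adj G v a -> adj G v b -> a != b ->
  path (adj G) a s -> last a s = b -> v \notin a :: s -> False.
Proof.
move=> va vb ab ps; case: (shortenP ps) => t pt ut ts tb vs.
have /Gtree.2 : cycle (adj G) (v :: a :: t).
  by rewrite /= rcons_path va pt /= tb adj_sym.
case: t tb pt ut ts => [/= ab'|c t tb _ ut ts]; first by rewrite ab' eqxx in ab.
suff -> : uniq [:: v, a, c & t] by move=> /(_ isT).
rewrite cons_uniq ut andbT; apply: contra vs; rewrite in_cons [v \in a :: s]in_cons.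
by case/orP => [->//|/ts ->]; rewrite orbT.
Qed.

(** Otherwise two geodesics to [y], from [x] and from a neighbour of [p] closer
    to [y], would join two neighbours of [p] without meeting [p]. *)
Lemma tree_step x p y : adj G x p -> V y ->
  d x y = (d p y).+1 \/ d p y = (d x y).+1.
Proof.
move=> xp Vy; have Vx := adj_vert xp; have Vp := adj_vertr xp.
have px : adj G p x by rewrite adj_sym.
have := dist_adj Gconn xp Vy; have := dist_adj Gconn px Vy.
suff : d x y <> d p y by lia.
move=> xy; have [n py] : exists n, d p y = n.+1.
  case py: (d p y) xy => [|n]; last by exists n.
  move/eqP: py; rewrite dist0 // => /eqP <-.
  by rewrite (dist_adj1 Gconn xp).
have [p1 pp1 p1y] := dist_step Gconn Vp Vy py; have Vp1 := adj_vertr pp1.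
have [s [ps sy sn]] := geodesic Gconn Vx Vy.
have [t [pt ty tn]] := geodesic Gconn Vp1 Vy.
have path_rev : path (adj G) y (rev (belast p1 t)).
  rewrite -ty rev_path (eq_path (e' := adj G)) // => u v.
  by rewrite adj_sym.
apply: (@tree_no_detour p x p1 (s ++ rev (belast p1 t))) => //.
- by apply/eqP => xp1; move: p1y; rewrite -xp1 xy py; lia.
- by rewrite cat_path ps sy.
- rewrite last_cat sy; case: t ty {pt tn path_rev} => //= a t _.
  by rewrite rev_cons last_rcons.
- rewrite in_cons mem_cat mem_rev; apply/negP => /orP[/eqP px'|/orP[/sn[_]|]].
  + by move: xp; rewrite px' adj_irrefl.
  + by rewrite xy ltnn.
  + move=> /mem_belast; rewrite in_cons => /orP[/eqP pp1'|/tn[_]].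
      by move: pp1; rewrite -pp1' adj_irrefl.
    by rewrite p1y py; lia.
Qed.

(** Two geodesics to [y] starting at distinct closer neighbours of [x] would
    join these neighbours without meeting [x]. *)
Lemma tree_closer_unique x p q y : adj G x p -> adj G x q -> V y ->
  d x y = (d p y).+1 -> d x y = (d q y).+1 -> p = q.
Proof.
move=> xp xq Vy xpy xqy; apply/eqP/negP => /negP pq.
have Vp := adj_vertr xp; have Vq := adj_vertr xq.
have [s [ps sy sn]] := geodesic Gconn Vp Vy.
have [t [pt ty tn]] := geodesic Gconn Vq Vy.
apply: (@tree_no_detour x p q (s ++ rev (belast q t))) => //.
- rewrite cat_path ps sy /= -ty rev_path (eq_path (e' := adj G)) // => u v.
  by rewrite adj_sym.
- rewrite last_cat sy; case: t ty {pt tn} => //= a t _.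
  by rewrite rev_cons last_rcons.
- rewrite in_cons mem_cat mem_rev; apply/negP => /orP[/eqP x'|/orP[/sn[_]|]].
  + by move: xp; rewrite -x' adj_irrefl.
  + by rewrite xpy; lia.
  + move=> /mem_belast; rewrite in_cons => /orP[/eqP x'|/tn[_]].
      by move: xq; rewrite -x' adj_irrefl.
    by rewrite xqy; lia.
Qed.

(** A walk that comes down to [x] and then leaves through another edge
    never turns back, so it is a geodesic. *)
Lemma tree_pass x p y u : adj G x p -> V y -> V u ->
  d p y = (d x y).+1 -> d x u = (d p u).+1 -> d y u = (d x y + d x u)%N.
Proof.
move=> + Vy Vu; move pun: (d p u) => n.
elim: n x p pun => [|n IHn] x p pun xp pxy xpu;
  have Vx := adj_vert xp; have Vp := adj_vertr xp.
  move/eqP: pun; rewrite dist0 // => /eqP <-.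
  by rewrite (distC Gconn Vy Vp) pxy (dist_adj1 Gconn xp) addn1.
have [p' pp' p'u] := dist_step Gconn Vp Vu pun; have Vp' := adj_vertr pp'.
have [pp'y|p'py] := tree_step pp' Vy.
  have xp' : x = p' by apply: (tree_closer_unique _ pp' Vy) => //; rewrite adj_sym.
  by move: xpu; rewrite xp' p'u; lia.
by rewrite (IHn _ _ p'u pp' p'py); lia.
Qed.

(** In a tree, the side of [p] when the edge [x -- p] is deleted
    ([component_del_edge]). *)
Definition branch x p : set nat := [set y | V y /\ d x y = (d p y).+1].

Lemma branchC x p y : adj G x p -> V y -> branch x p y \/ branch p x y.
Proof. by move=> xp Vy; have [] := tree_step xp Vy; [left|right]. Qed.

Lemma branch_sub x p q : adj G x p -> adj G p q -> q != x ->
  branch p x `<=` branch q p.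
Proof.
move=> xp pq qx y [Vy pxy]; split=> //; have [pqy|//] := tree_step pq Vy.
by move/eqP: qx; case; apply: (tree_closer_unique pq _ Vy) => //; rewrite adj_sym.
Qed.

Lemma branch_cover x p y : adj G x p -> branch x p y -> y <> p ->
  exists q, [/\ adj G p q, q != x & branch p q y].
Proof.
move=> xp [Vy xpy] yp; have Vp := adj_vertr xp.
case py : (d p y) => [|n].
  by move/eqP: py; rewrite dist0 // => /eqP py; case: yp.
have [q pq qy] := dist_step Gconn Vp Vy py; exists q; split=> //.
  by apply/eqP => qx; move: xpy; rewrite -qx; lia.
by split=> //; rewrite py qy.
Qed.

(** An edge from [branch x p] to [branch p x], oriented this way, lies on a
    geodesic from [p] to [x] by [tree_pass], so it is [p -- x] itself. *)
Lemma component_del_edge x p : adj G x p ->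
  component (del_edge G x p) p = branch x p.
Proof.
move=> xp; have Vx := adj_vert xp; have Vp := adj_vertr xp.
apply/seteqP; split=> [y [s ps <-]|y [Vy xpy]].
  have : branch x p p by split; rewrite // distxx // (dist_adj1 Gconn xp).
  move: ps; move: {2 4 6}p => w.
  elim: s w => //= z s IHs w /andP[/andP[wz /asboolPn nxp] zs] [Vw xpw].
  apply: IHs => //; have Vz := adj_vertr wz; split => //.
  have [//|pxz] := tree_step xp Vz.
  have := tree_step wz Vx; have := tree_step wz Vp.
  rewrite !(distC Gconn Vw) // !(distC Gconn Vz) // => hp hx.
  have wp : d w p = (d p w) by rewrite distC.
  have wx : d w x = (d x w) by rewrite distC.
  have zp : d z p = (d p z) by rewrite distC.
  have zx : d z x = (d x z) by rewrite distC.
  have := tree_pass wz Vp Vx; rewrite wp wx zp zx.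
  rewrite (distC Gconn Vp Vx) (dist_adj1 Gconn xp) => h.
  have [w0 x0] : d p w = 0%N /\ d x z = 0%N by lia.
  case: nxp; right; split.
    by move/eqP: x0; rewrite dist0 // => /eqP.
  by move/eqP: w0; rewrite dist0 // => /eqP.
have [s [ps sy sn]] := geodesic Gconn Vp Vy; exists s => //.
apply: (path_del_edge (w := x)) => //; first by left.
rewrite in_cons; apply/negP => /orP[/eqP xp'|/sn[_]]; last by lia.
by move: xp; rewrite -xp' adj_irrefl.
Qed.

Lemma weak_edgeP x p : adj G x p ->
  weak_edge G x p <-> finite_set (branch x p) \/ finite_set (branch p x).
Proof.
move=> xp; rewrite -(component_del_edge xp) -(@component_del_edge p x) 1?adj_sym //.
by rewrite (component_del_edgeC G p x); split=> [[_ []]|]; [right|left|case; split=> //; tauto].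
Qed.

End Tree.

(** * Spheres in graphs of bounded degree *)

Lemma double_count_ge (e : rel nat) (A B : seq nat) (c : nat) :
  {in A, forall a, (c <= count (e a) B)%N} ->
  {in B, forall b, (count (e ^~ b) A <= 1)%N} -> (c * size A <= size B)%N.
Proof.
move=> hA hB; rewrite mulnC -(count_predT A) -(count_predT B) -!sum1_count.
rewrite big_distrl /=; apply: (@leq_trans (\sum_(a <- A) \sum_(b <- B) e a b)).
  rewrite big_seq [leqRHS]big_seq; apply: leq_sum => a aA.
  rewrite mul1n; apply: leq_trans (hA _ aA) _.
  by rewrite -sum1_count big_mkcond /=; apply: leq_sum => b _; case: (e a b).
rewrite exchange_big /= big_seq [leqRHS]big_seq; apply: leq_sum => b bB.
apply: leq_trans (hB _ bB); rewrite -sum1_count [leqRHS]big_mkcond /=.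
by apply: leq_sum => a _; case: (e a b).
Qed.

Lemma double_count_le (e : rel nat) (A B : seq nat) (c : nat) :
  {in A, forall a, (count (e a) B <= c)%N} ->
  {in B, forall b, has (e ^~ b) A} -> (size B <= c * size A)%N.
Proof.
move=> hA hB; rewrite mulnC -(count_predT A) -(count_predT B) -!sum1_count.
rewrite big_distrl /=; apply: (@leq_trans (\sum_(b <- B) \sum_(a <- A) e a b)).
  rewrite big_seq [leqRHS]big_seq; apply: leq_sum => b bB.
  have := hB _ bB; rewrite has_count -sum1_count big_mkcond /= => /leq_trans; apply.
  by apply: leq_sum => a _; case: (e a b).
rewrite exchange_big /= big_seq [leqRHS]big_seq; apply: leq_sum => a aA.
rewrite mul1n; apply: leq_trans (hA _ aA); rewrite -sum1_count [leqRHS]big_mkcond /=.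
by apply: leq_sum => b _; case: (e a b).
Qed.

Definition enum_set (A : set nat) : seq nat := enum_fset (fset_set A).

Lemma enum_set_uniq A : uniq (enum_set A).
Proof. exact: fset_uniq. Qed.

Lemma mem_enum_set A x : finite_set A -> x \in enum_set A <-> A x.
Proof. by move=> fA; rewrite /enum_set in_fset_set // in_setE. Qed.

Lemma finite_nbr k (G : graph) x : degree_le k G ->
  finite_set [set y | adj G x y].
Proof.
move=> Gd; have [Vx|nVx] := pselect (vert G x).
  by apply/finite_set_leP; exists k; exact: Gd.
by rewrite (_ : [set y | _] = set0) // -subset0 => y /= /adj_vert.
Qed.

Lemma finite_gball k (G : graph) x n : degree_le k G -> finite_set (gball G x n).
Proof.
move=> Gd; elim: n x => [|n IHn] x.
  by apply: sub_finite_set (finite_set1 x) => y /gball0.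
apply: (@sub_finite_set _ _ ([set x] `|` \bigcup_(p in [set p | adj G x p]) gball G p n)).
  by move=> y /gballS[->|[p xp py]]; [left|right; exists p].
by rewrite finite_setU; split=> //; apply: bigcup_finite => //; exact: finite_nbr Gd.
Qed.

Section Spheres.
Variables (G : graph) (k : nat).
Hypothesis Gconn : connected_graph G.
Hypothesis Gdeg : degree_le k G.
Implicit Types x y o : nat.
Local Notation V := (vert G).
Local Notation d := (dist G).

Definition sphere o n : set nat := [set y | V y /\ d o y = n].

Lemma finite_sphere o n : V o -> finite_set (sphere o n).
Proof.
move=> Vo; apply: sub_finite_set (finite_gball o n Gdeg) => y [Vy <-].
exact: dist_ball.
Qed.

Lemma mem_sphere o n y : V o -> y \in enum_set (sphere o n) <-> V y /\ d o y = n.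
Proof. by move=> Vo; rewrite mem_enum_set //; exact: finite_sphere. Qed.

Lemma mem_nbr x y : y \in enum_set [set y | adj G x y] = adj G x y.
Proof. by have [h1 h2] := mem_enum_set y (finite_nbr x Gdeg); apply/idP/idP. Qed.

Lemma size_nbr x : V x -> (size (enum_set [set y | adj G x y]) <= k)%N.
Proof.
move=> Vx; apply: geq_card_fset_set; exact: Gdeg.
Qed.

(** Every vertex of the larger sphere has a neighbour in the smaller one, whose
    vertices each have a neighbour closer to [o], hence at most [k - 1] others. *)
Lemma size_sphereS o n : V o ->
  (size (enum_set (sphere o n.+2)) <= k.-1 * size (enum_set (sphere o n.+1)))%N.
Proof.
move=> Vo; apply: (@double_count_le (adj G)) => [a|b] /(mem_sphere _ _ Vo)[Va ao].
  have [c ac co] : exists2 c, adj G a c & d c o = n.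
    by apply: dist_step; rewrite // distC.
  have Vc := adj_vertr ac.
  rewrite -size_filter.
  suff /leq_trans /(_ (size_nbr Va)) : (size [seq x <- enum_set (sphere o n.+2) | adj G a x] <
          size (enum_set [set y | adj G a y]))%N by case: (k).
  rewrite -/(size (c :: [seq x <- enum_set (sphere o n.+2) | adj G a x])).
  apply: uniq_leq_size; rewrite /= ?filter_uniq ?enum_set_uniq ?andbT //.
    rewrite mem_filter ac /=; apply/negP => /(mem_sphere _ _ Vo)[_].
    by rewrite distC // co; lia.
  by move=> z; rewrite mem_nbr in_cons mem_filter => /predU1P[->//|/andP[]].
have [c bc co] : exists2 c, adj G b c & d c o = n.+1.
  by apply: dist_step; rewrite // distC.
have Vc := adj_vertr bc.
apply/hasP; exists c; last by rewrite adj_sym.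
by apply/(mem_sphere _ _ Vo); split; rewrite // distC.
Qed.

Lemma size_sphere0 o : V o -> size (enum_set (sphere o 0)) = 1%N.
Proof.
move=> Vo; apply/eqP; rewrite eqn_leq; apply/andP; split.
  apply: (@uniq_leq_size _ _ [:: o]) => [|y]; first exact: enum_set_uniq.
  move=> /(mem_sphere _ _ Vo)[Vy /eqP]; rewrite dist0 // => /eqP ->.
  exact: mem_head.
apply: (@uniq_leq_size _ [:: o]) => // y; rewrite inE => /eqP ->.
by apply/(mem_sphere _ _ Vo); rewrite distxx.
Qed.

Lemma size_sphere1 o : V o -> (size (enum_set (sphere o 1)) <= k)%N.
Proof.
move=> Vo; apply: leq_trans (size_nbr Vo).
apply: uniq_leq_size => [|y]; first exact: enum_set_uniq.
move=> /(mem_sphere _ _ Vo)[Vy oy]; rewrite mem_nbr.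
have [p op /eqP] := dist_step Gconn Vo Vy oy; have Vp := adj_vertr op.
by rewrite dist0 // => /eqP <-.
Qed.

Lemma size_sphere q o n : (k <= q.+1)%N -> (0 < q)%N -> V o ->
  (size (enum_set (sphere o n)) <= 2 * q ^ n)%N.
Proof.
move=> kq q0 Vo; case: n => [|n]; first by rewrite size_sphere0.
elim: n => [|n IHn]; first by have := size_sphere1 Vo; lia.
apply: leq_trans (size_sphereS n Vo) _.
apply: (@leq_trans (q * (2 * q ^ n.+1))); last by rewrite mulnCA -expnS.
by apply: leq_mul => //; lia.
Qed.

End Spheres.

(** In a tree a vertex has at most one neighbour that is not farther from [o],
    so spheres grow at least by the factor [k - 1]. *)
Lemma size_sphere_regular (G : graph) k o n : is_tree G ->
  (forall x, vert G x -> ([set y | adj G x y] #= `I_k)%card) -> vert G o ->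
  (k.-1 ^ n <= size (enum_set (sphere G o n)))%N.
Proof.
move=> Gtree Gk Vo; have Gconn := Gtree.1.
have Gdeg : degree_le k G by move=> x /Gk; rewrite card_eq_le => /andP[].
elim: n => [|n IHn]; first by rewrite (size_sphere0 Gconn Gdeg).
rewrite expnS; apply: leq_trans (leq_mul (leqnn _) IHn) _.
have memS := mem_sphere Gconn Gdeg _ _ Vo.
apply: (@double_count_ge (adj G)) => [a|b] /memS[Va oa].
  have nbr_a : size (enum_set [set y | adj G a y]) = k.
    by apply: card_fset_set; exact: Gk.
  pose S := enum_set (sphere G o n.+1).
  pose far := mem S; pose near := predC far.
  have near1 : (count near (enum_set [set y | adj G a y]) <= 1)%N.
    rewrite -size_filter; set N := seq.filter _ _.
    have Nu : uniq N by rewrite filter_uniq ?enum_set_uniq.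
    have Nc y : y \in N -> adj G a y /\ dist G a o = (dist G y o).+1.
      rewrite mem_filter (mem_nbr Gdeg) => /andP[/negP yS ay]; split=> //.
      have [//|yo] := tree_step Gtree ay Vo; case: yS; have Vy := adj_vertr ay.
      by apply/memS; split; rewrite // distC // yo distC // oa.
    case: N Nu Nc => [//|y [//|z N]] /= /andP[+ _] Nc.
    have [ay yo] := Nc y (mem_head _ _).
    have [az zo] : adj G a z /\ dist G a o = (dist G z o).+1 by apply: Nc; rewrite !inE eqxx orbT.
    by rewrite (tree_closer_unique Gtree ay az Vo yo zo) mem_head.
  have far_le : (count far (enum_set [set y | adj G a y]) <= count (adj G a) S)%N.
    rewrite -!size_filter; apply: uniq_leq_size => [|y].
      by rewrite filter_uniq ?enum_set_uniq.
    by rewrite !mem_filter (mem_nbr Gdeg) andbC.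
  have := count_predC far (enum_set [set y | adj G a y]).
  by rewrite nbr_a -/near -subn1 leq_subLR addnC => <-; exact: leq_add.
rewrite -size_filter; set N := seq.filter _ _.
have Nu : uniq N by rewrite filter_uniq ?enum_set_uniq.
have Nc y : y \in N -> adj G b y /\ dist G b o = (dist G y o).+1.
  rewrite mem_filter adj_sym => /andP[bz] /memS[Vz oz]; split=> //.
  by rewrite distC // oa distC // oz.
case: N Nu Nc => [//|y [//|z N]] /= /andP[+ _] Nc.
have [ay yo] := Nc y (mem_head _ _).
have [az zo] : adj G b z /\ dist G b o = (dist G z o).+1 by apply: Nc; rewrite !inE eqxx orbT.
by rewrite (tree_closer_unique Gtree ay az Vo yo zo) mem_head.
Qed.

(** * The spine of a tree *)

Lemma finite_bounded (A : set nat) (f : nat -> nat) : finite_set A ->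
  exists N, forall b, A b -> (f b < N)%N.
Proof.
move=> fA; exists (\max_(b <- enum_set A) f b).+1 => b Ab.
by rewrite ltnS; apply: leq_bigmax_seq => //; apply/mem_enum_set.
Qed.

(** In a tree, this says that [branch G u p] reaches depth [n] ([deepP]). Being
    phrased with balls, it can be read off a ball around [u] in any graph. *)
Definition deep (G : graph) n u p := exists b, gball G p n b /\ ~ gball G u n b.

Section Spine.
Variables (G : graph) (k : nat).
Hypothesis Gtree : is_tree G.
Hypothesis Gdeg : degree_le k G.
Implicit Types x y z p q u : nat.
Local Notation V := (vert G).
Local Notation d := (dist G).
Local Notation T' := (vert (spine G)).

Let Gconn : connected_graph G. Proof. by case: Gtree. Qed.

Lemma deepP n u p : adj G u p ->
  deep G n u p <-> exists2 b, branch G u p b & d p b = n.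
Proof.
move=> up; have Vu := adj_vert up; have Vp := adj_vertr up.
split=> [[b [pb ub]]|[b [Vb ub] pb]].
  have Vb := gball_vert Vp pb; exists b.
    split=> //; have := dist_adj Gconn up Vb; have := gball_distW pb.
    suff : (n < d u b)%N by lia.
    by rewrite ltnNge; apply/negP => /(dist_ball Gconn Vu Vb).
  have := dist_adj Gconn up Vb; have := gball_distW pb.
  suff : (n < d u b)%N by lia.
  by rewrite ltnNge; apply/negP => /(dist_ball Gconn Vu Vb).
exists b; split; first by apply: dist_ball; rewrite ?pb.
by move/gball_distW; rewrite ub pb ltnn.
Qed.

Lemma infinite_branch_deep u p n : adj G u p -> infinite_set (branch G u p) ->
  deep G n u p.
Proof.
move=> up inf; have Vu := adj_vert up; have Vp := adj_vertr up.
have [b ub pbn] : exists2 b, branch G u p b & (n <= d p b)%N.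
  apply: contrapT => none; apply: inf.
  apply: sub_finite_set (finite_gball p n Gdeg) => b [Vb ub].
  apply: dist_ball => //; apply: contrapT => pbn; apply: none.
  by exists b; [split|lia].
have [Vb ubE] := ub.
have [c [Vc pc pcb]] := dist_between Gconn Vp Vb pbn.
apply/deepP => //; exists c => //; split=> //.
have := dist_adj Gconn up Vc; have := distD Gconn Vu Vc Vb; lia.
Qed.

Lemma finite_branch_deep u p : adj G u p -> finite_set (branch G u p) ->
  exists N, forall n, (N <= n)%N -> ~ deep G n u p.
Proof.
move=> up /(finite_bounded (d p))[N Nb]; exists N => n Nn /(deepP _ up)[b /Nb + pb].
by rewrite pb; lia.
Qed.

Definition strong x p :=
  [/\ adj G x p, infinite_set (branch G x p) & infinite_set (branch G p x)].

Lemma strong_sym x p : strong x p -> strong p x.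
Proof. by move=> [xp ? ?]; split; rewrite // adj_sym. Qed.

Lemma not_strong_weak x p : adj G x p -> ~ strong x p <-> weak_edge G x p.
Proof.
move=> xp; rewrite (weak_edgeP Gtree xp); split=> [ns|[fin|fin] [_ i1 i2]//].
by apply: contrapT => /not_orP[i1 i2]; apply: ns.
Qed.

Lemma strong_partP x p : adj (strong_part G) x p <-> strong x p.
Proof.
split=> [/andP[xp /asboolPn/not_orP[/(not_strong_weak xp)/contrapT]]//|sxp].
have [xp _ _] := sxp; have px : adj G p x by rewrite adj_sym.
rewrite /= xp; apply/asboolPn => -[/(not_strong_weak xp)//|].
by move/(not_strong_weak px); apply; exact: strong_sym.
Qed.

(** Beyond a strong edge the infinite branch splits into finitely many
    branches, one of which is infinite. *)
Lemma strong_extend x p : strong x p -> exists2 q, strong p q & q != x.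
Proof.
move=> [xp inf inf']; have Vp := adj_vertr xp; apply: contrapT => none.
apply: inf; apply: (@sub_finite_set _ _
  ([set p] `|` \bigcup_(q in [set q | adj G p q /\ q != x]) branch G p q)).
  move=> y xpy; have [->|/eqP yp] := eqVneq y p; first by left.
  by have [q [pq qx pqy]] := branch_cover Gtree xp xpy yp; right; exists q.
rewrite finite_setU; split; first exact: finite_set1.
apply: bigcup_finite => [|q [pq qx]].
  by apply: sub_finite_set (finite_nbr p Gdeg) => q [].
apply: contrapT => infq; apply: none; exists q => //; split=> //.
by apply: sub_infinite_set inf'; exact: branch_sub.
Qed.

(** Repeated extension of a strong edge gives strong edges at every distance,
    which is why the component of a strong edge is infinite. *)
Lemma strong_ray x p n : strong x p -> exists a b,
  [/\ component (strong_part G) x a, strong a b, d x a = n & d x b = n.+1].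
Proof.
move=> sxp; have [xp _ _] := sxp; have Vx := adj_vert xp.
elim: n => [|n [a [b [xa sab xan xbn]]]].
  exists x, p; split=> //; last exact: dist_adj1.
    by exists [::].
  by rewrite distxx.
have [c sbc ca] := strong_extend sab; exists b, c; split=> //.
  apply: component_trans xa _; exists [:: b] => //=.
  by rewrite andbT; apply/strong_partP.
have [ab _ _] := sab; have [bc _ _] := sbc.
have Va := adj_vert ab; have Vb := adj_vert bc; have Vc := adj_vertr bc.
have ba : adj G b a by rewrite adj_sym.
have [bcx|] := tree_step Gtree bc Vx; last by rewrite !(distC Gconn _ Vx) // => ->; rewrite xbn.
move/eqP: ca; case; apply: (tree_closer_unique Gtree bc ba Vx bcx).
by rewrite !(distC Gconn _ Vx) // xbn xan.
Qed.

Lemma vert_spineP u : T' u <-> exists p, strong u p.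
Proof.
split=> [[Vu]|[p sup]].
  move=> /= inf; apply: contrapT => none; apply: inf.
  apply: sub_finite_set (finite_set1 u) => y [[|p s] /= ps]; first by move=> <-.
  by case: none; exists p; apply/strong_partP; case/andP: ps.
split; first by have [/adj_vert] := sup.
move=> /= fin; have [N Nb] := finite_bounded (d u) fin.
have [a [b [ua _ uaN _]]] := strong_ray N sup.
by have := Nb _ ua; rewrite uaN ltnn.
Qed.

Lemma vert_spine_vert u : T' u -> V u.
Proof. by case. Qed.

Lemma adj_spineP x p : adj (spine G) x p <-> strong x p.
Proof.
split=> [/and3P[/strong_partP]//|sxp].
have Tx : T' x by apply/vert_spineP; exists p.
have Tp : T' p by apply/vert_spineP; exists x; exact: strong_sym.
by apply/and3P; split; [exact/strong_partP|apply/asboolP|apply/asboolP]; [case: Tx|case: Tp].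
Qed.

(** The spine goes on beyond [y], away from [x], through an infinite branch
    contained in [branch G x p]. *)
Lemma spine_branch x p y : adj G x p -> branch G x p y -> T' y ->
  infinite_set (branch G x p).
Proof.
move=> xp [Vy xpy] /vert_spineP[q0 sq0].
have Vx := adj_vert xp; have Vp := adj_vertr xp.
have [q [yq inf _] qx] : exists2 q, strong y q & d q x = (d y x).+1.
  have [yq0 _ _] := sq0; have [yx|q0x] := tree_step Gtree yq0 Vx; last by exists q0.
  have [r syr rq0] := strong_extend (strong_sym sq0); exists r => //.
  have [yr _ _] := syr; have [yrx|//] := tree_step Gtree yr Vx.
  by move/eqP: rq0; case; apply: (tree_closer_unique Gtree yr yq0 Vx).
have Vq := adj_vertr yq.
apply: sub_infinite_set inf => z [Vz yqz]; split=> //.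
rewrite (tree_pass Gtree yq Vx Vz qx yqz).
have qp : d q p = (d y p).+1.
  have [|//] := tree_step Gtree yq Vp => yp.
  have := dist_adj Gconn xp Vq; have := distC Gconn Vx Vq; have := distC Gconn Vp Vq.
  have := distC Gconn Vx Vy; have := distC Gconn Vp Vy; lia.
rewrite (tree_pass Gtree yq Vp Vz qp yqz).
by rewrite (distC Gconn Vy Vx) xpy (distC Gconn Vp Vy).
Qed.

(** The first edge of a geodesic between two vertices of the spine has an
    infinite branch on both sides; so the spine is convex. *)
Lemma spine_step x y n : T' x -> T' y -> d x y = n.+1 ->
  exists2 p, strong x p & d p y = n.
Proof.
move=> Tx Ty xyn; have Vx := vert_spine_vert Tx; have Vy := vert_spine_vert Ty.
have [p xp py] := dist_step Gconn Vx Vy xyn; exists p => //.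
have Vp := adj_vertr xp; have px : adj G p x by rewrite adj_sym.
split=> //; first by apply: (spine_branch (y := y)) => //; split; rewrite // xyn py.
by apply: (spine_branch (y := x)) => //; split; rewrite // distxx // (dist_adj1 Gconn).
Qed.

Lemma gball_spine_sub x n : gball (spine G) x n `<=` gball G x n.
Proof.
move=> y [s [ps sy sn]]; exists s; split=> //.
by apply: sub_path ps => u v /adj_spineP[].
Qed.

Lemma gball_spineP x y n : T' x -> T' y ->
  gball (spine G) x n y <-> (d x y <= n)%N.
Proof.
move=> Tx Ty; split=> [/gball_spine_sub/gball_distW//|].
elim: n x Tx => [|n IHn] x Tx; case xy : (d x y) => [|m] // xyn;
  do ?by move/eqP: xy; rewrite dist0 //; try exact: vert_spine_vert;
    move=> /eqP ->; exact: gball_refl.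
have [p sxp py] := spine_step Tx Ty xy.
have Tp : T' p by apply/vert_spineP; exists x; exact: strong_sym.
have pny : gball (spine G) p n y by apply: IHn => //; lia.
by apply: (@gball_trans _ x p y 1) => //; apply/gball_adj/adj_spineP.
Qed.

Lemma spine_connected : connected_graph (spine G).
Proof.
move=> x y Tx Ty; have /(gball_spineP _ Tx Ty)[s [ps sy _]] := leqnn (d x y).
by exists s.
Qed.

Lemma dist_spine x y : T' x -> T' y -> dist (spine G) x y = d x y.
Proof.
move=> Tx Ty; apply/eqP; rewrite eqn_leq; apply/andP; split.
  by apply: gball_distW; apply/gball_spineP.
by apply/(gball_spineP _ Tx Ty)/dist_ball => //; exact: spine_connected.
Qed.

(** The witness is a vertex of the spine closest to [x]: by [spine_step], a
    geodesic of the tree from it to another vertex of the spine starts in the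
    spine, hence away from [x]. *)
Lemma spine_projection x : V x -> T' !=set0 ->
  exists2 p, T' p & forall u, T' u -> d x u = (d x p + d p u)%N.
Proof.
move=> Vx [u0 Tu0].
have ex : exists n, `[< exists2 p, T' p & d x p = n >].
  by exists (d x u0); apply/asboolP; exists u0.
case: (ex_minnP ex) => m /asboolP[p Tp xpm] min; exists p => // u Tu.
have Vp := vert_spine_vert Tp; have Vu := vert_spine_vert Tu.
case pu : (d p u) => [|n].
  by move/eqP: pu; rewrite dist0 // addn0 => /eqP ->.
have [q spq qu] := spine_step Tp Tu pu; have [pq _ _] := spq.
have Tq : T' q by apply/vert_spineP; exists p; exact: strong_sym.
have Vq := vert_spine_vert Tq.
rewrite -pu (distC Gconn Vx Vp); apply: (tree_pass Gtree pq) => //; last by rewrite pu qu.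
have [|//] := tree_step Gtree pq Vx.
rewrite !(distC Gconn _ Vx) // xpm => mE.
have /min : `[< exists2 p, T' p & d x p = d x q >] by apply/asboolP; exists q.
by rewrite mE ltnn.
Qed.

(** Along a path from [x] to [y] the distance to [z] changes by one at each
    edge. The edges being weak, the sign of each change is the same for all [z]
    outside of a finite set. *)
Lemma eventually_level x y : ~ (T' !=set0) -> V x -> V y ->
  exists N (e : int), forall z, V z -> (N <= d x z)%N ->
    (d y z : int) = ((d x z : int) + e)%R.
Proof.
move=> noT Vx Vy; have weak p q : adj G p q -> weak_edge G p q.
  move=> pq; apply/not_strong_weak => // spq; apply: noT.
  by exists p; apply/vert_spineP; exists q.
have [s ps sy] := Gconn Vx Vy; subst y.
elim/last_ind: s ps {Vy} => [|s y IHs]; first by exists 0%N, 0%R => z; rewrite addr0.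
rewrite rcons_path last_rcons => /andP[ps uy].
have [N [e Ne]] := IHs ps; set u := last x s in uy Ne.
have [fin|fin] := (weak_edgeP Gtree uy).1 (weak _ _ uy);
  have [M Mb] := finite_bounded (d x) fin.
- exists (maxn N M), (e + 1)%R => z Vz; rewrite geq_max => /andP[/(Ne z Vz) uz Mz].
  have [/Mb|[_ yuz]] := branchC Gtree uy Vz; first by lia.
  by rewrite yuz; lia.
- exists (maxn N M), (e - 1)%R => z Vz; rewrite geq_max => /andP[/(Ne z Vz) uz Mz].
  have [[_ uyz]|/Mb] := branchC Gtree uy Vz; last by lia.
  by rewrite uyz in uz; lia.
Qed.

End Spine.

(** * Isomorphisms of balls *)

Definition adj_preserving (A : set nat) f G H :=
  forall x y, A x -> A y -> adj H (f x) (f y) = adj G x y.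

Lemma adj_preserving_gball A f G H x n y : adj_preserving A f G H ->
  gball G x n `<=` A -> gball G x n y -> gball H (f x) n (f y).
Proof.
move=> fadj; elim: n x => [|n IHn] x xA.
  by move/gball0 => ->; exact: gball_refl.
case/gballS => [->|[p xp py]]; first exact: gball_refl.
have pA : gball G p n `<=` A.
  by move=> z pz; apply: xA; rewrite -add1n; apply: gball_trans pz; exact: gball_adj.
apply: (@gball_trans _ _ (f p) _ 1); last exact: IHn.
apply: gball_adj; rewrite fadj //; first exact/xA/gball_refl.
exact/pA/gball_refl.
Qed.

Lemma set_bij_inverse (A B : set nat) f : set_bij A B f -> exists g,
  (forall x, A x -> g (f x) = x) /\ (forall y, B y -> A (g y) /\ f (g y) = y).
Proof.
move=> [fV finj fsurj].
have /boolp.choice[g gP] y : exists x, B y -> A x /\ f x = y.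
  have [By|nBy] := pselect (B y); last by exists 0%N.
  by have [x Ax fx] := fsurj _ By; exists x.
exists g; split=> // x Ax; have [Agx fgx] := gP _ (fV _ Ax).
by apply: finj => //; rewrite inE.
Qed.

Definition local_iso n f G H x :=
  set_bij (gball G x n) (gball H (f x) n) f /\
  adj_preserving (gball G x n) f G H.

Lemma local_iso_restrict A B n f G H x : set_bij A B f ->
  adj_preserving A f G H -> gball G x n `<=` A -> gball H (f x) n `<=` B ->
  local_iso n f G H x.
Proof.
move=> fbij fadj xA xB; have [g [gK fK]] := set_bij_inverse fbij.
have gadj : adj_preserving B g H G.
  move=> y z By Bz; have [Ay fy] := fK _ By; have [Az fz] := fK _ Bz.
  by rewrite -{2}fy -{2}fz fadj.
have Ax : A x by exact/xA/gball_refl.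
split; last by move=> y z xy xz; apply: fadj; exact: xA.
split=> [y|y z|y xy].
- exact: (adj_preserving_gball fadj xA).
- by rewrite !inE => /xA Ay /xA Az; case: fbij => _ + _; apply; rewrite inE.
- have [_ fy] := fK _ (xB _ xy); exists (g y) => //.
  by rewrite -(gK _ Ax); exact: adj_preserving_gball gadj xB xy.
Qed.

Lemma local_iso_sym n f G H x : local_iso n f G H x -> exists g,
  [/\ local_iso n g H G (f x), forall y, gball G x n y -> g (f y) = y &
    forall y, gball H (f x) n y -> f (g y) = y].
Proof.
move=> [fbij fadj]; have [g [gK fK]] := set_bij_inverse fbij.
have gx : g (f x) = x by apply: gK; exact: gball_refl.
exists g; split=> //; last by move=> y /fK[].
apply: (@local_iso_restrict (gball H (f x) n) (gball G x n)) => //.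
- split=> [y /fK[]//|y z|y xy].
  + by rewrite !inE => /fK[_ fy] /fK[_ fz] yz; rewrite -fy yz.
  + by exists (f y); [case: fbij => + _ _; apply|exact: gK].
- move=> y z /fK[Ay fy] /fK[Az fz].
  by rewrite -{2}fy -{2}fz fadj.
- by rewrite gx.
Qed.

Section LocalIso.
Variables (n : nat) (f : nat -> nat) (G H : graph) (x : nat).
Hypothesis f_iso : local_iso n f G H x.

Lemma local_iso_ball i a : (i <= n)%N -> gball G x i a -> gball H (f x) i (f a).
Proof.
move=> i_n; case: f_iso => _ fadj; apply: adj_preserving_gball fadj _.
exact: gball_le.
Qed.

Lemma local_iso_gball i l a b : (i + l <= n)%N -> gball G x i a ->
  gball G a l b -> gball H (f a) l (f b).
Proof.
move=> iln xa; case: f_iso => _ fadj; apply: adj_preserving_gball fadj _.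
by move=> z az; apply: (gball_le iln); exact: gball_trans az.
Qed.

Lemma local_iso_move i l a : (i + l <= n)%N -> gball G x i a ->
  local_iso l f G H a.
Proof.
move=> iln xa; have [fbij fadj] := f_iso.
apply: local_iso_restrict fbij fadj _ _ => z az; apply: (gball_le iln).
  exact: gball_trans az.
by apply: gball_trans az; exact: (local_iso_ball (leq_trans (leq_addr l i) iln) xa).
Qed.

End LocalIso.

Lemma local_iso_gballP n f G H x i l a b : local_iso n f G H x ->
  (i + l <= n)%N -> gball G x i a -> gball G x n b ->
  gball H (f a) l (f b) <-> gball G a l b.
Proof.
move=> fiso iln xa xb; split; last exact: (local_iso_gball fiso iln xa).
have [g [giso gK _]] := local_iso_sym fiso.
have xa' : gball G x n a by apply: gball_le xa; exact: leq_trans (leq_addr l i) iln.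
move=> ab; rewrite -(gK _ xb) -[in gball G a](gK _ xa').
apply: (local_iso_gball giso iln _ ab).
exact: (local_iso_ball fiso (leq_trans (leq_addr l i) iln) xa).
Qed.

Lemma local_iso_dist n f G H x y : local_iso n f G H x -> gball G x n y ->
  dist H (f x) (f y) = dist G x y.
Proof.
move=> fiso xy; have [g [giso gK _]] := local_iso_sym fiso.
have xx : gball G x 0 x by exact: gball_refl.
have fxy := local_iso_ball fiso (leqnn _) xy.
have [l1 b1] := gball_dist xy; have [l2 b2] := gball_dist fxy.
apply/eqP; rewrite eqn_leq; apply/andP; split; apply: gball_distW.
  exact: (local_iso_ball fiso).
by apply/(local_iso_gballP fiso _ xx xy).
Qed.

Section MarkedIso.
Variables d k : nat.
Implicit Types G H : marked_graph d k.

Lemma ball_iso_local n G H : ball_iso n G H -> exists f,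
  [/\ map f (mark_seq G) = mark_seq H,
      forall x y, marks_ball G n x -> marks_ball G n y -> f x = f y -> x = y &
      forall x, x \in mark_seq G -> local_iso n f G H x].
Proof.
move=> [f [fbij fadj fm]]; exists f; split=> // [x y|x xG].
  by move=> Ax Ay; case: fbij => _ + _; apply; rewrite inE.
apply: local_iso_restrict fbij fadj _ _ => y xy; first by exists x.
by exists (f x) => //; rewrite -fm map_f.
Qed.

Lemma iso_ball_iso n G H : iso G H -> ball_iso n G H.
Proof.
move=> [f [fbij fadj fm]]; exists f; have [g [gK fK]] := set_bij_inverse fbij.
have loc x : x \in mark_seq G -> local_iso n f G H x.
  move=> xG; apply: local_iso_restrict fbij fadj _ _ => y xy.
    by apply: gball_vert xy; exact: mark_seq_vert xG.
  by apply: gball_vert xy; apply: (@mark_seq_vert _ _ H); rewrite -fm map_f.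
have ballV : marks_ball G n `<=` vert G.
  by move=> y [x /mark_seq_vert Vx] /(gball_vert Vx).
split=> //; last by move=> x y /ballV Vx /ballV Vy; exact: fadj.
split=> [y [x xG xy]|x y|y [x']].
- exists (f x); first by rewrite -fm map_f.
  exact: (local_iso_ball (loc _ xG) (leqnn _) xy).
- by rewrite !inE => /ballV Vx /ballV Vy; case: fbij => _ + _; apply; rewrite inE.
- rewrite -fm => /mapP[x xG ->] xy.
  have [[_ _ /(_ _ xy)[z xz <-]] _] := loc _ xG.
  by exists z => //; exists x.
Qed.

Lemma iso_reprK G : iso (repr (\pi_(iso_class d k) G)%qT) G.
Proof. by have /eqmodP/asboolP := reprK (\pi_(iso_class d k) G)%qT. Qed.

(** Such a function is locally constant, so all preimages are open. *)
Lemma local_measurable disp (E : measurableType disp) (h : borel_class d k -> E)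
    (n : nat) :
  (forall c c' : borel_class d k, ball_iso n (repr (c : iso_class d k))
    (repr (c' : iso_class d k)) -> h c = h c') ->
  measurable_fun setT h.
Proof.
move=> hloc _ Y mY; rewrite setTI; apply: sub_sigma_algebra.
have lo : local_open (h @^-1` Y).
  by move=> c Yc; exists n => c' cc'; rewrite /preimage /= -(hloc _ _ cc').
change (open (h @^-1` Y : set (iso_class d k))); rewrite openE => c Yc.
change (exists B : set (iso_class d k),
  [/\ local_open B, B c & B `<=` h @^-1` Y]).
by exists (h @^-1` Y); split=> // c'.
Qed.

End MarkedIso.

(** * Mass transport along local kernels *)

Section LocalKernel.
Context {R : realType}.
Local Open Scope ring_scope.

(** Both the mass sent and the mass received by a vertex along a local kernel
    are locally constant functions of the rooted graph, hence measurable. *)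
Definition local_kernel (N r : nat) (K : graph -> nat -> nat -> R) :=
  [/\ forall G x y, 0 <= K G x y,
      forall G x y, ~ gball G x N y -> K G x y = 0,
      (N <= r)%N &
      forall G H f x y, local_iso r f G H x -> gball G x N y ->
        K H (f x) (f y) = K G x y].

Variables (d N r : nat) (K : graph -> nat -> nat -> R).
Hypothesis Kloc : local_kernel N r K.

Let K0 G x y : 0 <= K G x y. Proof. by case: Kloc. Qed.
Let Kout G x y : ~ gball G x N y -> K G x y = 0. Proof. by case: Kloc => _ + _ _; apply. Qed.
Let Nr : (N <= r)%N. Proof. by case: Kloc. Qed.
Let Kiso G H f x y : local_iso r f G H x -> gball G x N y ->
  K H (f x) (f y) = K G x y.
Proof. by case: Kloc => _ _ _; apply. Qed.

Definition transport (c : birooted_graph d) : R :=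
  let M := repr (c : iso_class d 2) in
  K M (nth 0%N (mark_seq M) 0) (nth 0%N (mark_seq M) 1).

Lemma kernel_ball_iso (G H : marked_graph d 2) : ball_iso r G H ->
  K H (nth 0%N (mark_seq H) 0) (nth 0%N (mark_seq H) 1) =
  K G (nth 0%N (mark_seq G) 0) (nth 0%N (mark_seq G) 1).
Proof.
move=> /ball_iso_local[f [fm finj floc]].
have sG : size (mark_seq G) = 2%N by rewrite size_map size_tuple.
have xG : nth 0%N (mark_seq G) 0 \in mark_seq G by rewrite mem_nth // sG.
have yG : nth 0%N (mark_seq G) 1 \in mark_seq G by rewrite mem_nth // sG.
rewrite -fm !(nth_map 0%N) ?sG //.
set x := nth 0%N (mark_seq G) 0 in xG *; set y := nth 0%N (mark_seq G) 1 in yG *.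
have [xy|nxy] := pselect (gball G x N y); first exact: Kiso (floc _ xG) xy.
rewrite !Kout // => fxy; apply: nxy.
have [[_ _ fsurj] _] := local_iso_move (floc _ xG) (Nr : (0 + N <= r)%N) (gball_refl _ _ _).
have [z xz fz] := fsurj _ fxy; suff <- : z = y by [].
apply: finj fz; last by exists y => //; exact: gball_refl.
by exists x => //; exact: gball_le xz.
Qed.

Lemma transportE (G : marked_graph d 1) (x y : vertex G) :
  transport (birooted x y) = K G (val x) (val y).
Proof.
rewrite /transport /birooted; set M := MarkedGraph _ _ _.
by have /kernel_ball_iso <- := iso_ball_iso r (iso_reprK M).
Qed.

Lemma transport_ge0 c : 0 <= transport c.
Proof. exact: K0. Qed.

Lemma measurable_transport : measurable_fun setT transport.
Proof.
by apply: (@local_measurable d 2 _ _ _ r) => c c' /kernel_ball_iso e; rewrite /transport e.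
Qed.

Lemma esum_ball (G : marked_graph d 1) o (F : nat -> R) :
  vert G o -> (forall x, 0 <= F x) -> (forall x, ~ gball G o N x -> F x = 0) ->
  (\esum_(x in [set: vertex G]) (F (val x))%:E =
    (\sum_(x \in gball G o N) F x)%:E)%E.
Proof.
move=> Vo F0 Fout; have fin := finite_gball o N (@base_degree _ _ G).
rewrite -(reindex_esum setT (vert G) val (fun x => (F x)%:E)); last first.
  split=> [x _|x y _ _ /val_inj//|x Vx]; first exact: set_valP.
  by exists (SigSub (mem_set Vx)).
rewrite -fsumEFin // -esum_fset //; last by move=> x _; rewrite lee_fin.
rewrite (_ : gball G o N = vert G `&` gball G o N); last first.
  by rewrite setIidr // => x; exact: gball_vert.
rewrite esum_mkcondr; apply: eq_esum => x Vx; case: ifPn => //.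
by rewrite notin_setE => /Fout ->.
Qed.

Definition received (c : rooted_graph d) : R :=
  \sum_(x \in gball (rep c) (val (Defs.root (rep c))) N)
     K (rep c) x (val (Defs.root (rep c))).

Lemma mass_inE (c : rooted_graph d) : mass_in transport c = (received c)%:E.
Proof.
rewrite /mass_in /received -esum_ball.
- by apply: eq_esum => x _; rewrite transportE.
- exact: set_valP.
- by [].
- by move=> x nx; apply: Kout => /gball_sym.
Qed.

Lemma mass_outE (c : rooted_graph d) : mass_out transport c =
  (\sum_(y \in gball (rep c) (val (Defs.root (rep c))) N)
     K (rep c) (val (Defs.root (rep c))) y)%:E%R.
Proof.
rewrite /mass_out -esum_ball.
- by apply: eq_esum => x _; rewrite transportE.
- exact: set_valP.
- by [].
- by move=> x nx; apply: Kout.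
Qed.

Lemma root_mark (G : marked_graph d 1) : mark_seq G = [:: val (Defs.root G)].
Proof.
rewrite /mark_seq /Defs.root; case: G => G Gc Gd m /=.
by case: m => -[|x [|y s]] //= szm; rewrite /thead (tnth_nth x).
Qed.

Lemma root_ball_iso n (c c' : rooted_graph d) : ball_iso n (rep c) (rep c') ->
  exists2 f, f (val (Defs.root (rep c))) = val (Defs.root (rep c')) &
    local_iso n f (rep c) (rep c') (val (Defs.root (rep c))).
Proof.
move=> /ball_iso_local[f [+ _ floc]]; rewrite !root_mark => -[fo].
by exists f => //; apply: floc; rewrite root_mark mem_head.
Qed.

Lemma measurable_received : measurable_fun setT received.
Proof.
apply: (@local_measurable d 1 _ _ _ (N + r)) => c c' /root_ball_iso[f fo floc].
rewrite /received -fo; set o := val _.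
have [fbij _] := local_iso_move floc (leq_addr r N : (0 + N <= N + r)%N) (gball_refl _ _ _).
rewrite (reindex_fsbig _ _ _ _ fbij); apply: eq_fsbigr => x; rewrite inE => ox.
symmetry; apply: Kiso; last exact: gball_sym.
exact: (local_iso_move floc (leqnn _) ox).
Qed.

Lemma measurable_mass_out :
  measurable_fun [set: rooted_graph d] (mass_out transport).
Proof.
rewrite (_ : mass_out transport = EFin \o (fun c : rooted_graph d =>
    \sum_(y \in gball (rep c) (val (Defs.root (rep c))) N)
     K (rep c) (val (Defs.root (rep c))) y)); last exact/funext/mass_outE.
apply/measurable_EFinP.
apply: (@local_measurable d 1 _ _ _ r) => c c' /root_ball_iso[f fo floc].
rewrite -fo; set o := val _.
have [fbij _] := local_iso_move floc (Nr : (0 + N <= r)%N) (gball_refl _ _ _).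
rewrite (reindex_fsbig _ _ _ _ fbij); apply: eq_fsbigr => x; rewrite inE => ox.
by symmetry; exact: Kiso.
Qed.

Section Expectation.
Context disp (Omega : measurableType disp) (P : probability Omega R).
Variable T : {RV P >-> rooted_graph d}.
Hypothesis Tunimod : unimodular T.
Hypothesis K_out_le1 : forall (c : rooted_graph d),
  \sum_(y \in gball (rep c) (val (Defs.root (rep c))) N)
     K (rep c) (val (Defs.root (rep c))) y <= 1.
Local Open Scope ereal_scope.

Lemma expected_received_le1 : \int[P]_w (received (T w))%:E <= 1.
Proof.
have out1 : \int[P]_w mass_out transport (T w) <= 1.
  rewrite -[leRHS](@probability_setT _ _ _ P) -[leRHS]mul1e -integral_cst //.
  apply: ge0_le_integral => //.
  - by move=> w _; apply: esum_ge0 => x _; rewrite lee_fin transport_ge0.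
  - exact: measurableT_comp measurable_mass_out _.
  - by move=> w _; rewrite mass_outE lee_fin.
have -> : \int[P]_w (received (T w))%:E = \int[P]_w mass_in transport (T w).
  by apply: eq_integral => w _; rewrite mass_inE.
rewrite -Tunimod //; [exact: measurable_transport|exact: transport_ge0|].
by left; apply: le_lt_trans out1 _; rewrite ltry.
Qed.

End Expectation.

End LocalKernel.

(** * The almost sure bound *)

Section Liminf.
Context {R : realType}.
Local Open Scope ereal_scope.

Lemma limn_einf_ge (u : (\bar R)^nat) a n0 :
  (forall n, (n0 <= n)%N -> a <= u n) -> a <= limn_einf u.
Proof.
move=> au; rewrite limn_einf_lim; apply: lime_ge; first exact: is_cvg_einfs.
exists n0 => // n /= n0n; apply: le_ereal_inf_tmp => _ [m /= nm <-].
by apply: au; exact: leq_trans nm.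
Qed.

Lemma limn_einf_le (u : (\bar R)^nat) a : (forall n, u n <= a) ->
  limn_einf u <= a.
Proof.
move=> ua; rewrite limn_einf_lim; apply: lime_le; first exact: is_cvg_einfs.
by apply: nearW => n; apply: ge_ereal_inf => /=; exists (u n) => //; exists n => /=.
Qed.

Lemma measurable_limn_einf disp (T : measurableType disp) (f : (T -> \bar R)^nat) :
  (forall n, measurable_fun setT (f n)) ->
  measurable_fun setT (fun x => limn_einf (f ^~ x)).
Proof.
move=> mf; apply: (measurableT_comp (@oppe_measurable _ _)).
apply: (measurable_fun_limn_esup (f := fun n x => - f n x)) => n.
exact: (measurableT_comp (@oppe_measurable _ _)).
Qed.

End Liminf.

Lemma ler_sum_subseq (R : numDomainType) (X Y : seq nat) (F : nat -> R) :
  uniq X -> uniq Y -> {subset X <= Y} -> (forall y, y \in Y -> 0 <= F y)%R ->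
  (\sum_(x <- X) F x <= \sum_(y <- Y) F y)%R.
Proof.
move=> uX uY XY F0; rewrite [leRHS](bigID [in X]) /=.
have -> : (\sum_(y <- Y | y \in X) F y = \sum_(x <- X) F x)%R.
  rewrite -big_filter; apply: perm_big; apply: uniq_perm; rewrite ?filter_uniq // => y.
  by rewrite mem_filter; apply/andP/idP => [[]//|yX]; split=> //; exact: XY.
by rewrite lerDl big_seq_cond; apply: sumr_ge0 => y /andP[/F0].
Qed.

(** One implication suffices, local isomorphisms being invertible
    ([local_relP]). *)
Definition local_rel (S : graph -> nat -> nat -> Prop) :=
  forall l, exists r, forall G H f x y, local_iso r f G H x -> gball G x l y ->
    S G x y -> S H (f x) (f y).

Lemma local_relP S : local_rel S -> forall l, exists2 r, (l <= r)%N &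
  forall G H f x y, local_iso r f G H x -> gball G x l y ->
    S H (f x) (f y) <-> S G x y.
Proof.
move=> Sloc l; have [r rP] := Sloc l; exists (r + l)%N; first exact: leq_addl.
move=> G H f x y fiso xy.
have xx : gball G x 0 x by exact: gball_refl.
have fr : local_iso r f G H x by apply: (local_iso_move fiso _ xx); rewrite leq_addr.
split; last exact: rP.
have fl : local_iso l f G H x by apply: (local_iso_move fiso _ xx); rewrite leq_addl.
have [g [giso gK _]] := local_iso_sym fiso.
move=> Sxy.
have gr : local_iso r g H G (f x).
  by apply: (local_iso_move giso _ (gball_refl _ _ 0)); rewrite leq_addr.
rewrite -(gK _ (gball_le (leq_addl r l) xy)) -{1}(gK _ (gball_refl G x (r + l))).
by apply: (rP _ _ _ _ _ gr) => //; exact: (local_iso_ball fl).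
Qed.

Section Normalized.
Context {R : realType}.
Variables (S : graph -> nat -> nat -> Prop) (s : R) (N : nat).
Hypothesis s0 : (0 < s)%R.
Hypothesis Sloc : local_rel S.
Local Open Scope ring_scope.

Definition targets G x : set nat := [set y | gball G x N y /\ S G x y].

Definition total_weight G x : R := \sum_(y \in targets G x) s ^+ dist G x y.

(** The division by the total weight makes the mass sent at most one in every
    graph, which is the integrability that unimodularity asks for. *)
Definition normalized G x y : R :=
  if `[< targets G x y >] then s ^+ dist G x y / total_weight G x else 0.

Lemma total_weight_ge0 G x : 0 <= total_weight G x.
Proof. by apply: fsumr_ge0 => y _; exact/exprn_ge0/ltW. Qed.

Lemma normalized_local : exists r, local_kernel N r normalized.
Proof.
have [r Nr rP] := local_relP Sloc N; exists r; split=> //.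
- move=> G x y; rewrite /normalized; case: ifP => // _.
  by rewrite divr_ge0 ?total_weight_ge0 // exprn_ge0 // ltW.
- by move=> G x y nxy; rewrite /normalized; case: asboolP => // -[].
move=> G H f x y fiso xy.
have fr : local_iso N f G H x by apply: (local_iso_move fiso _ (gball_refl _ _ 0)).
have targetsP z : gball G x N z -> targets H (f x) (f z) <-> targets G x z.
  move=> xz; split=> -[xz' Sxz]; split=> //; try exact/(rP _ _ _ _ _ fiso xz).
  exact: (local_iso_ball fr).
have bij : set_bij (targets G x) (targets H (f x)) f.
  case: fr => -[ff finj fsurj] _; split=> [z [xz Sz]|z w|z [xz Sz]].
  - exact/targetsP.
  - by rewrite !inE => -[xz _] [xw _]; apply: finj; rewrite inE.
  - by have [w xw wz] := fsurj _ xz; exists w => //; apply/(targetsP _ xw); rewrite wz.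
rewrite /normalized; have -> : `[< targets H (f x) (f y) >] = `[< targets G x y >].
  by apply: asbool_equiv_eq; exact: targetsP.
case: asboolP => // _; rewrite (local_iso_dist fr xy); congr (_ / _).
rewrite /total_weight (reindex_fsbig _ _ _ _ bij); apply: eq_fsbigr => z.
by rewrite inE => -[xz _]; rewrite (local_iso_dist fr xz).
Qed.

Lemma normalized_le1 k G x : degree_le k G ->
  \sum_(y \in gball G x N) normalized G x y <= 1.
Proof.
move=> Gd.
have -> : \sum_(y \in gball G x N) normalized G x y =
    total_weight G x / total_weight G x.
  rewrite {1}/total_weight mulr_fsuml {1}(_ : targets G x = gball G x N `&` targets G x); last first.
    by rewrite setIidr // => y [].
  rewrite fsbig_mkcondr; apply: eq_fsbigr => y _; rewrite /normalized.
  by have -> : (y \in targets G x) = `[< targets G x y >] by apply/idP/asboolP; rewrite inE.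
have [->|w0] := eqVneq (total_weight G x) 0; first by rewrite mul0r.
by rewrite divff.
Qed.

Lemma total_weight_le k G x W : degree_le k G ->
  (forall X, uniq X -> (forall y, y \in X -> targets G x y) ->
     \sum_(y <- X) s ^+ dist G x y <= W) -> total_weight G x <= W.
Proof.
move=> Gd XW; have fin : finite_set (targets G x).
  by apply: sub_finite_set (finite_gball x N Gd) => y [].
rewrite /total_weight fsbig_finite //; apply: XW => [|y]; first exact: fset_uniq.
by rewrite in_fset_set // in_setE.
Qed.

End Normalized.

Section AlmostSure.
Context {R : realType} (d : nat).
Context disp (Omega : measurableType disp) (P : probability Omega R).
Variable T : {RV P >-> rooted_graph d}.
Hypothesis Tunimod : unimodular T.
Variables (Q : nat -> graph -> nat -> nat -> Prop) (s : R).
Hypothesis s0 : (0 < s)%R.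
Hypothesis Qloc : forall n, local_rel (Q n).
Local Open Scope ereal_scope.

Definition inner_liminf (c : rooted_graph d) N : \bar R :=
  limn_einf (fun n => (received N (normalized (Q n) s N) c)%:E).

Definition received_liminf (c : rooted_graph d) : \bar R :=
  limn_einf (fun N => inner_liminf c N).

(** The mean of the mass received is at most one for each [n] and [N], and
    Fatou's lemma preserves this bound for both inferior limits. *)
Lemma ae_received_liminf : {ae P, forall w, received_liminf (T w) < +oo}.
Proof.
have loc n N := normalized_local N s0 (Qloc n).
have rec0 N n (c : rooted_graph d) : 0 <= (received N (normalized (Q n) s N) c : R)%:E.
  have [r [K0 _ _ _]] := loc n N.
  by rewrite lee_fin; apply: fsumr_ge0 => x _; exact: K0.
have mrec N n : measurable_fun setT
    (fun w => (received N (normalized (Q n) s N) (T w) : R)%:E).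
  have [r Kl] := loc n N; apply/measurable_EFinP.
  exact: (measurableT_comp (measurable_received (d := d) Kl)).
have erec N n : \int[P]_w (received N (normalized (Q n) s N) (T w))%:E <= 1.
  have [r Kl] := loc n N; apply: (expected_received_le1 Kl Tunimod) => c.
  by apply: normalized_le1; exact: (@base_degree _ _ (rep c)).
have minner N : measurable_fun setT (fun w => inner_liminf (T w) N).
  exact: measurable_limn_einf.
have inner0 N w : 0 <= inner_liminf (T w) N by apply: (limn_einf_ge (n0 := 0)).
have einner N : \int[P]_w inner_liminf (T w) N <= 1.
  have /le_trans := fatou P measurableT (mrec N) (fun n w _ => rec0 N n (T w)).
  by apply; exact: limn_einf_le.
have mlim : measurable_fun setT (fun w => received_liminf (T w)).
  exact: measurable_limn_einf.
have lim0 w : 0 <= received_liminf (T w) by apply: (limn_einf_ge (n0 := 0)).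
have elim : \int[P]_w received_liminf (T w) <= 1.
  have /le_trans := fatou P measurableT minner (fun N w _ => inner0 N w).
  by apply; exact: limn_einf_le.
have /(integrable_ae measurableT) : P.-integrable setT (fun w => received_liminf (T w)).
  apply/integrableP; split=> //.
  under eq_integral do rewrite gee0_abs //.
  by apply: le_lt_trans elim _; rewrite ltry.
by apply: filterS => w /(_ I); rewrite ge0_fin_numE.
Qed.

(** For [N] large, all senders in the finite set [X] reach [o]. For [n] large,
    depending on [N], the relations [Q n] and [S] agree between [X] and the
    vertices within distance [N], so the total weights that occur are at most
    [W]. *)
Lemma received_bound (c : rooted_graph d) (S : nat -> nat -> Prop) (W : nat -> R) :
  let o := val (Defs.root (rep c)) in let G := base_graph (rep c) in
  received_liminf c < +oo ->
  (forall x y, vert G x -> vert G y ->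
     exists n0, forall n, (n0 <= n)%N -> Q n G x y <-> S x y) ->
  (forall x X, vert G x -> uniq X -> (forall y, y \in X -> vert G y /\ S x y) ->
     \sum_(y <- X) s ^+ dist G x y <= W x)%R ->
  exists C : R, forall X, uniq X -> (forall x, x \in X -> vert G x /\ S x o) ->
     (\sum_(x <- X) s ^+ dist G x o / W x <= C)%R.
Proof.
move=> o G fin QS SW; have Gd : degree_le d G := @base_degree _ _ (rep c).
have Gconn : connected_graph G := @base_connected _ _ (rep c).
have Vo : vert G o := set_valP _.
exists (fine (received_liminf c)) => X uX XS.
rewrite -lee_fin fineK; last first.
  rewrite ge0_fin_numE //; apply: (limn_einf_ge (n0 := 0)) => N _.
  apply: (limn_einf_ge (n0 := 0)) => n _; rewrite lee_fin.
  have [r [K0 _ _ _]] := normalized_local N s0 (Qloc n).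
  by apply: fsumr_ge0 => x _; exact: K0.
apply: (limn_einf_ge (n0 := \max_(x <- X) dist G x o)) => N XN.
have Xo x : x \in X -> gball G x N o.
  move=> xX; have [Vx _] := XS _ xX; apply: dist_ball => //.
  by apply: leq_trans XN; exact: leq_bigmax_seq.
have [n0 n0P] : exists n0, forall n x y, (n0 <= n)%N -> x \in X -> gball G x N y ->
    Q n G x y <-> S x y.
  have [F FP] : exists F : nat -> nat -> nat, forall x y, vert G x -> vert G y ->
      forall n, (F x y <= n)%N -> Q n G x y <-> S x y.
    have h x y : exists m, vert G x -> vert G y ->
        forall n, (m <= n)%N -> Q n G x y <-> S x y.
      have [[Vx Vy]|nV] := pselect (vert G x /\ vert G y); last first.
        by exists 0%N => Vx Vy; case: nV.
      by have [m mP] := QS _ _ Vx Vy; exists m.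
    have /boolp.choice[F FP] x : exists F : nat -> nat, forall y, vert G x ->
        vert G y -> forall n, (F y <= n)%N -> Q n G x y <-> S x y.
      by have /boolp.choice[F FP] := h x; exists F.
    by exists F.
  exists (\max_(x <- X) \max_(y <- enum_set (gball G x N)) F x y) => n x y n0n xX xy.
  have [Vx _] := XS _ xX; apply: FP => //; first exact: gball_vert xy.
  apply: leq_trans n0n; apply: leq_trans (leq_bigmax_seq _ xX isT).
  by apply: leq_bigmax_seq => //; apply/mem_enum_set => //; exact: finite_gball Gd.
apply: (limn_einf_ge (n0 := n0)) => n n0n; rewrite lee_fin.
have [r [K0 _ _ _]] := normalized_local N s0 (Qloc n).
rewrite /received fsbig_finite; last exact: finite_gball Gd.
apply: (@le_trans _ _ (\sum_(x <- X) normalized (Q n) s N G x o)%R); last first.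
  apply: ler_sum_subseq => // [|x xX]; first exact: fset_uniq.
  by rewrite in_fset_set ?in_setE; [exact/gball_sym/Xo|exact: finite_gball Gd].
rewrite big_seq [leRHS]big_seq; apply: ler_sum => x xX.
have [Vx Sxo] := XS _ xX.
have txo : targets (Q n) N G x o by split; [exact: Xo|apply/n0P => //; exact: Xo].
rewrite /normalized asboolT // ler_pM2l ?exprn_gt0 // lef_pV2 ?posrE; last 2 first.
- apply: lt_le_trans (SW x [:: o] Vx _ _) => //.
    by rewrite big_seq1 exprn_gt0.
  by move=> y; rewrite inE => /eqP ->.
- apply: lt_le_trans (_ : s ^+ dist G x o <= _)%R; first by rewrite exprn_gt0.
  have tfin : finite_set (targets (Q n) N G x).
    by apply: sub_finite_set (finite_gball x N Gd) => y [].
  rewrite /total_weight (fsbigD1 o) //= lerDl.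
  by apply: fsumr_ge0 => y _; rewrite exprn_ge0 // ltW.
apply: (total_weight_le Gd) => Y uY YT; apply: SW => // y /YT[xy Qxy].
by split; [exact: gball_vert xy|exact/(n0P n x y n0n xX xy)].
Qed.

End AlmostSure.

(** * Local relations that detect the spine and the end *)

(** Approximates, as [n] grows, that [y] is within distance [j] of the spine.
    The neighbourhood of the spine is used instead of the spine so that the root
    can be assumed to belong to it. *)
Definition near_spine j n (G : graph) (x y : nat) := exists u p,
  [/\ gball G y j u, adj G u p, deep G n u p & deep G n p u].

(** Approximates, as [n] grows, that [y] is not farther than [x] from the
    unique end of a tree. *)
Definition level n (G : graph) (x y : nat) :=
  forall z, gball G x n.+1 z -> ~ gball G x n z -> gball G y n.+1 z.

Lemma deep_local_iso r f G H x i n u p : local_iso r f G H x ->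
  (i.+1 + n <= r)%N -> gball G x i.+1 u -> gball G x i.+1 p ->
  deep G n u p -> deep H n (f u) (f p).
Proof.
move=> fiso inr xu xp [b [pb nub]]; exists (f b).
have xb : gball G x r b by apply: gball_le inr _ _; exact: gball_trans pb.
by split; [exact: (local_iso_gball fiso inr xp)|move/(local_iso_gballP fiso inr xu xb)].
Qed.

Lemma near_spine_local j n : local_rel (near_spine j n).
Proof.
move=> l; exists ((l + j).+1 + n)%N => G H f x y fiso xy [u [p [yu up du dp]]].
have xu : gball G x (l + j) u by exact: gball_trans yu.
have xu1 : gball G x (l + j).+1 u by apply: gball_le xu.
have xp : gball G x (l + j).+1 p.
  by rewrite -addn1; apply: gball_trans xu _; exact: gball_adj.
exists (f u), (f p); split.
- by apply: (local_iso_gball fiso _ xy yu); lia.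
- case: (fiso) => _ fadj; rewrite fadj //.
    exact: (gball_le (leq_addr n _) xu1).
  exact: (gball_le (leq_addr n _) xp).
- exact: (deep_local_iso fiso (leqnn _) xu1 xp).
- exact: (deep_local_iso fiso (leqnn _) xp xu1).
Qed.

Lemma level_local n : local_rel (level n).
Proof.
move=> l; exists (l + n.+1)%N => G H f x y fiso xy lev z' xz' nxz'.
have n1 : local_iso n.+1 f G H x.
  by apply: (local_iso_move fiso _ (gball_refl _ _ 0)); rewrite leq_addl.
have [[_ _ /(_ _ xz')[z xz zz']] _] := n1; subst z'.
apply: (local_iso_gball fiso (leqnn _) xy); apply: lev => // xnz; apply: nxz'.
by apply: (local_iso_ball n1).
Qed.

Section Limits.
Variables (G : graph) (k : nat).
Hypothesis Gtree : is_tree G.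
Hypothesis Gdeg : degree_le k G.
Local Notation V := (vert G).
Local Notation d := (dist G).
Local Notation T' := (vert (spine G)).

Let Gconn : connected_graph G. Proof. by case: Gtree. Qed.

Definition spine_nbhd j y := exists2 u, T' u & gball G y j u.

Lemma near_spine_limit j x y : exists n0, forall n, (n0 <= n)%N ->
  near_spine j n G x y <-> spine_nbhd j y.
Proof.
have [F FP] : exists F : nat -> nat -> nat, forall u p n, adj G u p ->
    ~ strong G u p -> (F u p <= n)%N -> ~ (deep G n u p /\ deep G n p u).
  have h u p : exists m, adj G u p -> ~ strong G u p ->
      forall n, (m <= n)%N -> ~ (deep G n u p /\ deep G n p u).
    have [[up ns]|nh] := pselect (adj G u p /\ ~ strong G u p); last first.
      by exists 0%N => up ns; case: nh.
    have pu : adj G p u by rewrite adj_sym.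
    have [fin|fin] := (weak_edgeP Gtree up).1 ((not_strong_weak Gtree up).1 ns).
      have [N NP] := finite_branch_deep Gtree up fin.
      by exists N => _ _ n /NP nd [].
    have [N NP] := finite_branch_deep Gtree pu fin.
    by exists N => _ _ n /NP nd [].
  have /boolp.choice[F FP] u : exists F : nat -> nat, forall p, adj G u p ->
      ~ strong G u p -> forall n, (F p <= n)%N -> ~ (deep G n u p /\ deep G n p u).
    by have /boolp.choice[F FP] := h u; exists F.
  by exists F => u p n up ns; exact: FP.
exists (\max_(u <- enum_set (gball G y j))
          \max_(p <- enum_set [set p | adj G u p]) F u p) => n n0n.
split=> [[u [p [yu up du dp]]]|[u Tu yu]].
  exists u => //; apply/(vert_spineP Gtree Gdeg); exists p; apply: contrapT => ns.
  apply: (FP u p n) => //; apply: leq_trans n0n.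
  have uin : u \in enum_set (gball G y j).
    by apply/mem_enum_set => //; exact: finite_gball Gdeg.
  apply: leq_trans (leq_bigmax_seq _ uin isT).
  by apply: leq_bigmax_seq => //; rewrite (mem_nbr Gdeg).
have [p [up i1 i2]] := (vert_spineP Gtree Gdeg u).1 Tu.
have pu : adj G p u by rewrite adj_sym.
by exists u, p; split=> //; apply: (infinite_branch_deep Gtree Gdeg).
Qed.

(** The comparison of the Busemann functions of [x] and [y], when the tree has
    one end. *)
Definition not_farther x y :=
  exists N, forall z, V z -> (N <= d x z)%N -> (d y z <= d x z)%N.

Hypothesis noT : ~ (T' !=set0).

Lemma not_farther_total x y : V x -> V y -> not_farther x y \/ not_farther y x.
Proof.
move=> Vx Vy; have [N [e Ne]] := eventually_level Gtree Gdeg noT Vx Vy.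
have [e0|e0] := leP e 0%R.
  by left; exists N => z Vz /(Ne z Vz); lia.
right; exists (N + d x y)%N => z Vz yz; have := Ne z Vz.
have := distD Gconn Vy Vx Vz; rewrite (distC Gconn Vy Vx); lia.
Qed.

Hypothesis Voo : infinite_set V.

Lemma exists_dist x n : V x -> exists2 z, V z & d x z = n.
Proof.
move=> Vx; have [z Vz xz] : exists2 z, V z & (n <= d x z)%N.
  apply: contrapT => none; apply: Voo; apply: sub_finite_set (finite_gball x n Gdeg).
  move=> z Vz; apply: dist_ball => //; apply: contrapT => nxz.
  by apply: none; exists z => //; lia.
by have [c [Vc xc _]] := dist_between Gconn Vx Vz xz; exists c.
Qed.

Lemma level_limit x y : V x -> V y -> exists n0, forall n, (n0 <= n)%N ->
  level n G x y <-> not_farther x y.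
Proof.
move=> Vx Vy; have [N [e Ne]] := eventually_level Gtree Gdeg noT Vx Vy.
exists N => n Nn; have e0 : not_farther x y <-> (e <= 0)%R.
  split=> [[M Mle]|e0]; last by exists N => z Vz /(Ne z Vz); lia.
  have [z Vz xz] := exists_dist (maxn N M) Vx.
  by have := Ne z Vz; have := Mle z Vz; rewrite xz; lia.
rewrite e0; split=> [lev|{}e0 z xz nxz].
  have [z Vz xz] := exists_dist n.+1 Vx.
  have /gball_distW : gball G y n.+1 z.
    by apply: lev; [apply: dist_ball; rewrite ?xz|move/gball_distW; rewrite xz ltnn].
  by have := Ne z Vz; rewrite xz; lia.
have Vz := gball_vert Vx xz; apply: dist_ball => //.
have := gball_distW xz; have : ~ (d x z <= n)%N by move/(dist_ball Gconn Vx Vz).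
by have := Ne z Vz; lia.
Qed.

End Limits.

(** * Exponential sums over trees *)

Section Sums.
Context {R : realType}.
Local Open Scope ring_scope.

Lemma geometric_sum_le (r : R) M : 0 <= r -> r < 1 ->
  \sum_(n < M) r ^+ n <= (1 - r)^-1.
Proof.
move=> r0 r1; have r1' : 0 < 1 - r by rewrite subr_gt0.
suff : (\sum_(n < M) r ^+ n) * (1 - r) <= 1 by rewrite -ler_pdivlMr // mul1r.
have -> : (\sum_(n < M) r ^+ n) * (1 - r) = 1 - r ^+ M.
  elim: M => [|M IHM]; first by rewrite big_ord0 mul0r expr0 subrr.
  by rewrite big_ord_recr /= mulrDl IHM exprSr mulrBr mulr1 addrA subrK.
by rewrite lerBlDr lerDl exprn_ge0.
Qed.

Section BallSum.
Variables (G : graph) (k : nat).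
Hypothesis Gconn : connected_graph G.
Hypothesis Gdeg : degree_le k G.
Local Notation V := (vert G).
Local Notation d := (dist G).

Lemma sum_by_sphere (r : R) x X : 0 <= r -> V x -> uniq X ->
  (forall y, y \in X -> V y) -> exists M,
  \sum_(y <- X) r ^+ d x y <= \sum_(n < M) (size (enum_set (sphere G x n)))%:R * r ^+ n.
Proof.
move=> r0 Vx uX XV; exists (\max_(y <- X) d x y).+1.
set M := (_.+1).
have -> : \sum_(y <- X) r ^+ d x y = \sum_(n < M) \sum_(y <- X | d x y == n) r ^+ n.
  rewrite (exchange_big_dep xpredT) //= big_seq [RHS]big_seq.
  apply: eq_bigr => y yX; have yM : (d x y < M)%N by rewrite ltnS leq_bigmax_seq.
  by rewrite (big_pred1 (Ordinal yM)) // => n /=; rewrite -val_eqE eq_sym.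
apply: ler_sum => n _; rewrite big_const_seq iter_addr_0 -[leLHS]mulr_natl.
apply: ler_wpM2r; first exact: exprn_ge0.
rewrite ler_nat -size_filter; apply: uniq_leq_size; first exact: filter_uniq.
move=> y; rewrite mem_filter => /andP[/eqP xy yX].
by apply/(mem_sphere Gconn Gdeg) => //; split=> //; exact: XV.
Qed.

Lemma ball_sum q (r : R) x X : (k <= q.+1)%N -> (0 < q)%N ->
  0 <= r -> q%:R * r < 1 -> V x -> uniq X -> (forall y, y \in X -> V y) ->
  \sum_(y <- X) r ^+ d x y <= 2 * (1 - q%:R * r)^-1.
Proof.
move=> kq q0 r0 qr Vx uX XV; have [M /le_trans->//] := sum_by_sphere r0 Vx uX XV.
have qr0 : 0 <= q%:R * r by rewrite mulr_ge0.
apply: (@le_trans _ _ (\sum_(n < M) 2 * (q%:R * r) ^+ n)); last first.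
  by rewrite -mulr_sumr ler_wpM2l // geometric_sum_le.
apply: ler_sum => n _; rewrite exprMn mulrA -natrX -natrM.
apply: ler_wpM2r; first exact: exprn_ge0.
by rewrite ler_nat (size_sphere Gconn Gdeg).
Qed.

End BallSum.

Section Green.
Variables (G : graph) (k q : nat) (s t : R).
Hypothesis Gtree : is_tree G.
Hypothesis Gdeg : degree_le k G.
Hypothesis kq : (k <= q.+1)%N.
Hypothesis q0 : (0 < q)%N.
Hypothesis s0 : 0 < s.
Hypothesis st : s < t.
Hypothesis qst : q%:R * (s * t) < 1.
Local Notation V := (vert G).
Local Notation d := (dist G).

Let Gconn : connected_graph G. Proof. by case: Gtree. Qed.

(** The vertices [y] are split according to the side of the first edge of the
    geodesic from [x] to [u] on which they lie. On the side of [x], [d y u] is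
    [d y x + d x u]; the other side is handled by induction. *)
Lemma green_sum : exists2 C : R, 0 < C & forall x u X, V x -> V u -> uniq X ->
  (forall y, y \in X -> V y) ->
  \sum_(y <- X) s ^+ d x y * t ^+ d y u <= C * t ^+ d x u.
Proof.
have t0 : 0 < t by exact: lt_trans st.
pose C0 := 2 * (1 - q%:R * (s * t))^-1.
have C00 : 0 < C0 by rewrite mulr_gt0 // invr_gt0 subr_gt0.
have C0P x X : V x -> uniq X -> (forall y, y \in X -> V y) ->
    \sum_(y <- X) (s * t) ^+ d x y <= C0.
  by move=> *; apply: (ball_sum Gconn Gdeg kq) => //; rewrite mulr_ge0 // ltW.
have ts : 0 < t - s by rewrite subr_gt0.
(* The constant solves [C0 * t + s * C = C * t], which closes the induction. *)
exists (C0 * t / (t - s)); first by rewrite divr_gt0 // mulr_gt0.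
move=> x u X + Vu uX XV; move xu: (d x u) => n; elim: n x xu => [|n IHn] x xu Vx.
  move/eqP: xu; rewrite dist0 // => /eqP xu; rewrite expr0 mulr1.
  apply: (@le_trans _ _ C0); last first.
    by rewrite -mulrA ler_peMr ?(ltW C00) // ler_pdivlMr // mul1r lerBlDr lerDl ltW.
  rewrite (le_trans _ (C0P x X Vx uX XV)) // big_seq [leRHS]big_seq.
  by apply: ler_sum => y /XV Vy; rewrite -xu exprMn (distC Gconn Vy Vx).
have [p xp pu] := dist_step Gconn Vx Vu xu; have Vp := adj_vertr xp.
apply: (@le_trans _ _ (\sum_(y <- X) ((s * t) ^+ d x y * t ^+ n.+1 +
                                      s * (s ^+ d p y * t ^+ d y u)))).
  rewrite big_seq [leRHS]big_seq; apply: ler_sum => y /XV Vy.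
  have a0 : 0 <= (s * t) ^+ d x y * t ^+ n.+1.
    by rewrite mulr_ge0 ?exprn_ge0 // ?mulr_ge0 // ltW.
  have [xy|py] := tree_step Gtree xp Vy.
    by rewrite xy exprS -mulrA lerDr -xy.
  rewrite (tree_pass Gtree xp Vy Vu py) ?xu ?pu // exprD mulrA -exprMn.
  by rewrite lerDl !mulr_ge0 ?exprn_ge0 // ltW.
rewrite big_split /= -mulr_suml -mulr_sumr.
apply: (@le_trans _ _ (C0 * t ^+ n.+1 + s * (C0 * t / (t - s) * t ^+ n))).
  apply: lerD; first by rewrite ler_wpM2r ?exprn_ge0 ?(ltW t0) // C0P.
  by rewrite ler_wpM2l ?(ltW s0) // IHn.
have : (t - s) * (t - s)^-1 = 1 by rewrite divff // gt_eqF.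
by move=> /(congr1 (fun e => C0 * t * t ^+ n * e)); rewrite exprS; lra.
Qed.

End Green.

End Sums.

(** * Growth and summability *)

Section GrowthSum.
Context {R : realType}.
Local Open Scope ring_scope.
Implicit Types (G : graph) (s t e : R).

Definition exp_summable G s o := exists C : R, forall X, uniq X ->
  (forall y, y \in X -> vert G y) -> \sum_(y <- X) s ^+ dist G o y <= C.

Definition ball_size G o n := size (enum_set (gball G o n)).

Lemma ball_size_gt0 k G o n : degree_le k G -> (0 < ball_size G o n)%N.
Proof.
move=> Gd; have : o \in enum_set (gball G o n).
  by apply/mem_enum_set; [exact: finite_gball Gd|exact: gball_refl].
by rewrite /ball_size; case: enum_set.
Qed.

Lemma limn_esup_lt (u : (\bar R)^nat) (a : \bar R) : (limn_esup u < a)%E ->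
  exists n0, forall n, (n0 <= n)%N -> (u n < a)%E.
Proof.
rewrite limn_esup_lim (cvg_lim _ (@cvg_esups_inf R u)) // => /ereal_inf_lt.
move=> [_ [m _ <-] ma]; exists m => n mn; apply: le_lt_trans ma.
by apply: ereal_sup_ubound => /=; exists n.
Qed.

Lemma limn_esup_le (u : (\bar R)^nat) (a : \bar R) n0 :
  (forall n, (n0 <= n)%N -> (u n <= a)%E) -> (limn_esup u <= a)%E.
Proof.
move=> ua; rewrite limn_esup_lim; apply: lime_le; first exact: is_cvg_esups.
exists n0 => // n /= n0n; apply: ge_ereal_sup => _ [m /= nm <-].
by apply: ua; exact: leq_trans nm.
Qed.

Lemma limn_esup_ge (u : (\bar R)^nat) (a : \bar R) :
  (forall n, (a <= u n)%E) -> (a <= limn_esup u)%E.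
Proof.
move=> ua; rewrite limn_esup_lim; apply: lime_ge; first exact: is_cvg_esups.
apply: nearW => n; apply: le_trans (ua n) _; apply: ereal_sup_ubound.
by exists n => /=.
Qed.

Lemma root_expr (b : R) n : 0 <= b -> (0 < n)%N -> (b `^ n%:R^-1) ^+ n = b.
Proof.
move=> b0 n0; rewrite -powR_mulrn ?powR_ge0 // -powRrM mulVf ?powRr1 //.
by rewrite pnatr_eq0 -lt0n.
Qed.

Lemma growth_at_ge1 k G o : degree_le k G -> (1%:E <= growth_at R G o)%E.
Proof.
move=> Gd; apply: limn_esup_ge => n; rewrite lee_fin.
have b1 : 1 <= (ball_size G o n)%:R :> R by rewrite ler1n (ball_size_gt0 _ _ Gd).
have [->|n0] := posnP n; first by rewrite invr0 powRr0.
rewrite -(ler_pXn2r n0) ?nnegrE ?powR_ge0 // expr1n root_expr //.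
Qed.

Lemma growth_at_summable k G s t o : connected_graph G -> degree_le k G ->
  vert G o -> 0 < s -> s < t -> (growth_at R G o < t^-1%:E)%E ->
  exp_summable G s o.
Proof.
move=> Gconn Gd Vo s0 st /limn_esup_lt[n0 n0P].
have t0 : 0 < t by exact: lt_trans st.
have tail n : (n0 < n)%N -> (ball_size G o n)%:R * t ^+ n <= 1.
  move=> n0n; have n1 : (0 < n)%N by lia.
  have := n0P n (ltnW n0n); rewrite lte_fin => /ltW.
  rewrite -(ler_pXn2r n1) ?nnegrE ?powR_ge0 ?invr_ge0 ?(ltW t0) //.
  by rewrite root_expr // exprVn -ler_pdivlMr ?exprn_gt0 // mul1r.
have [C [C0 CP]] : exists C : R, 0 <= C /\
    forall n, (ball_size G o n)%:R * t ^+ n <= C.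
  pose A := \sum_(i < n0.+1) (ball_size G o i)%:R * t ^+ i.
  have A0 : 0 <= A.
    by apply: sumr_ge0 => i _; rewrite mulr_ge0 ?exprn_ge0 ?(ltW t0).
  exists (1 + A); split=> [|n]; first by rewrite addr_ge0.
  have [nn0|/tail h] := leqP n n0; last by apply: le_trans h _; rewrite lerDl.
  rewrite /A (bigD1 (Ordinal (nn0 : (n < n0.+1)%N))) //= addrCA lerDl addr_ge0 //.
  by apply: sumr_ge0 => i _; rewrite mulr_ge0 ?exprn_ge0 ?(ltW t0).
exists (C * (1 - s / t)^-1) => X uX XV.
have [M /le_trans->//] := sum_by_sphere Gconn Gd (ltW s0) Vo uX XV.
apply: (@le_trans _ _ (\sum_(n < M) C * (s / t) ^+ n)).
  apply: ler_sum => n _; rewrite expr_div_n mulrCA [leRHS]mulrC; apply: ler_wpM2r.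
    by rewrite exprn_ge0 // ltW.
  rewrite ler_pdivlMr ?exprn_gt0 //; apply: le_trans (CP n).
  apply: ler_wpM2r; first by rewrite exprn_ge0 // ltW.
  rewrite ler_nat; apply: uniq_leq_size; first exact: enum_set_uniq.
  move=> y /(mem_sphere Gconn Gd _ _ Vo)[Vy oy].
  by apply/mem_enum_set; [exact: finite_gball Gd|apply: dist_ball; rewrite ?oy].
rewrite -mulr_sumr; apply: ler_wpM2l => //; apply: geometric_sum_le.
  by rewrite divr_ge0 // ltW.
by rewrite ltr_pdivrMr // mul1r.
Qed.

Lemma bernoulli_le (x : R) n : 0 <= x -> 1 + n%:R * x <= (1 + x) ^+ n.
Proof.
move=> x0; elim: n => [|n IHn]; first by rewrite mul0r addr0 expr0.
rewrite exprS; apply: (@le_trans _ _ ((1 + x) * (1 + n%:R * x))); last first.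
  by apply: ler_wpM2l => //; rewrite addr_ge0.
rewrite -natr1; have : 0 <= n%:R * x * x by rewrite !mulr_ge0.
lra.
Qed.

Lemma growth_at_le k G s e o : connected_graph G -> degree_le k G ->
  vert G o -> 0 < s -> s <= 1 -> s^-1 < e -> exp_summable G s o ->
  (growth_at R G o <= e%:E)%E.
Proof.
move=> Gconn Gd Vo s0 s1 se [C CP].
have e0 : 0 < e by apply: lt_trans se; rewrite invr_gt0.
have bC n : (ball_size G o n)%:R * s ^+ n <= C.
  apply: le_trans (CP (enum_set (gball G o n)) _ _); last 2 first.
  - exact: enum_set_uniq.
  - by move=> y /mem_enum_set yn; apply: gball_vert Vo _; apply: yn; exact: finite_gball Gd.
  rewrite /ball_size mulr_natl -iter_addr_0 -count_predT -big_const_seq big_seq [leRHS]big_seq.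
  apply: ler_sum => y yn; apply: ler_wiXn2l => //; first exact: ltW.
  by apply: gball_distW; apply/(mem_enum_set y (finite_gball o n Gd)).
have es : 0 < e * s - 1 by rewrite subr_gt0 -ltr_pdivrMr // mul1r.
have [n0 n0P] : exists n0 : nat, C <= n0%:R * (e * s - 1).
  exists (Num.trunc (C / (e * s - 1))).+1; rewrite -ler_pdivrMr //; exact/ltW/truncnS_gt.
apply: (limn_esup_le (n0 := n0.+1)) => n n0n; rewrite lee_fin.
have n1 : (0 < n)%N by lia.
rewrite -(ler_pXn2r n1) ?nnegrE ?powR_ge0 ?(ltW e0) // root_expr //.
rewrite -(ler_pM2r (exprn_gt0 n s0)) -exprMn; apply: le_trans (bC n) _.
apply: le_trans n0P _; have := bernoulli_le n (ltW es).
rewrite (_ : 1 + (e * s - 1) = e * s); last by rewrite addrC subrK.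
apply: le_trans; apply: ler_wpDl => //; apply: ler_wpM2r; [exact: ltW|rewrite ler_nat; lia].
Qed.

Lemma exp_summable_shift G s o o' : connected_graph G -> vert G o ->
  vert G o' -> 0 < s -> s <= 1 -> exp_summable G s o -> exp_summable G s o'.
Proof.
move=> Gconn Vo Vo' s0 s1 [C CP]; exists (C / s ^+ dist G o o') => X uX XV.
rewrite ler_pdivlMr ?exprn_gt0 //; apply: le_trans (CP X uX XV).
rewrite mulr_suml big_seq [leRHS]big_seq; apply: ler_sum => y /XV Vy.
rewrite -exprD; apply: ler_wiXn2l => //; first exact: ltW.
by rewrite addnC; exact: distD.
Qed.

Lemma growth_ge1 k G : degree_le k G -> vert G !=set0 -> (1%:E <= growth R G)%E.
Proof.
move=> Gd G0; rewrite /growth; case: pselect => // h; exact: growth_at_ge1 Gd.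
Qed.

Lemma growth_summable k G s t o : connected_graph G -> degree_le k G ->
  vert G o -> 0 < s -> s < t -> s <= 1 -> (growth R G < t^-1%:E)%E ->
  exp_summable G s o.
Proof.
move=> Gconn Gd Vo s0 st s1; rewrite /growth; case: pselect => [h|[]]; last by exists o.
case: cid => o' Vo' /= /(growth_at_summable Gconn Gd Vo' s0 st).
exact: exp_summable_shift.
Qed.

Lemma growth_le k G s e : connected_graph G -> degree_le k G ->
  0 < s -> s <= 1 -> s^-1 < e ->
  (forall o, vert G o -> exp_summable G s o) -> (growth R G <= e%:E)%E.
Proof.
move=> Gconn Gd s0 s1 se sum; rewrite /growth; case: pselect => [h|nh].
  by case: cid => o Vo /=; apply: (growth_at_le Gconn Gd Vo s0 s1 se); exact: sum.
by rewrite lee_fin; apply/ltW/(lt_trans _ se); rewrite invr_gt0.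
Qed.

(** Leaves room for the strict inequalities between the growth rates and the
    parameters of the sums. The parameter of a transport is rational because
    only countably many almost sure events can be intersected. *)
Lemma rational_parameter_between (x y : \bar R) : (1%:E <= x)%E -> (x < y)%E ->
  exists (r : rat) (t e : R),
  [/\ 0 < ratr r :> R, ratr r < t, t < 1, (x < t^-1%:E)%E &
      (ratr r)^-1 < e /\ (e%:E < y)%E].
Proof.
move=> x1 xy; have xfin : x \is a fin_num.
  by rewrite ge0_fin_numE; [exact: lt_le_trans xy (leey _)|apply: le_trans x1; rewrite lee_fin].
move: x1 xy; rewrite -(fineK xfin) lee_fin; move: (fine x) => a {xfin} a1 ay.
have [c ac cy] : exists2 c, a < c & (c%:E <= y)%E.
  case: y ay => [b||//]; rewrite ?lte_fin => ab; first by exists b.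
  by exists (a + 1); rewrite ?ltrDl // leey.
pose h := (c - a) / 4; have h0 : 0 < h by rewrite divr_gt0 // subr_gt0.
have ch : c = a + 4 * h by rewrite /h mulrC divfK // addrC subrK.
have lt13 : (a + 3 * h)^-1 < (a + h)^-1 by rewrite ltf_pV2 ?posrE; lra.
have [r] := rat_in_itvoo lt13; rewrite in_itv /= => /andP[r3 r1].
have s0 : 0 < ratr r :> R by apply: lt_trans r3; rewrite invr_gt0; lra.
exists r, (a + h)^-1, (a + 3 * h); split=> //.
- by rewrite invf_lt1; lra.
- by rewrite invrK lte_fin; lra.
- split; first by rewrite -ltf_pV2 ?posrE ?invr_gt0 // ?invrK //; lra.
  by apply: lt_le_trans cy; rewrite lte_fin ch; lra.
Qed.

End GrowthSum.

(** * From transports to growth *)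

Section Typical.
Context {R : realType} (d : nat).
Local Open Scope ring_scope.

(** The countably many almost sure properties that the proof uses. *)
Definition typical (c : rooted_graph d) := forall r : rat, 0 < ratr r :> R ->
  (forall j, (received_liminf (near_spine j) (ratr r : R) c < +oo)%E) /\
  (received_liminf level (ratr r : R) c < +oo)%E.

Variable c : rooted_graph d.
Hypothesis ctyp : typical c.
Local Notation G := (base_graph (rep c)).
Local Notation V := (vert G).
Local Notation T' := (vert (spine G)).
Local Notation dst := (dist G).
Local Notation o := (val (Defs.root (rep c))).
Hypothesis Gtree : is_tree G.

Let Gconn : connected_graph G. Proof. exact: (@base_connected _ _ (rep c)). Qed.
Let Gdeg : degree_le d G. Proof. exact: (@base_degree _ _ (rep c)). Qed.
Let Vo : V o. Proof. exact: set_valP. Qed.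
Let Sconn : connected_graph (spine G). Proof. exact: spine_connected Gtree Gdeg. Qed.
Let SV x : T' x -> V x. Proof. by case. Qed.

Variable q : nat.
Hypothesis dq : (d <= q.+1)%N.
Hypothesis q0 : (0 < q)%N.

Let q1 : 1 <= q%:R :> R. Proof. by rewrite ler1n. Qed.

(** Sending mass to the [j]-neighbourhood of the spine, where [j] is the
    distance from [o] to some vertex of the spine, makes [o] a receiver. By
    [green_sum] for an auxiliary [a < s], this neighbourhood weighs at most a
    constant times the spine. *)
Lemma spine_received (r : rat) (W : nat -> R) (s := ratr r : R) :
  0 < s -> s <= 1 -> T' !=set0 ->
  (forall x Y, V x -> uniq Y -> (forall u, u \in Y -> T' u) ->
     \sum_(u <- Y) s ^+ dst x u <= W x) ->
  exists C : R, forall X, uniq X -> (forall x, x \in X -> V x) ->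
     \sum_(x <- X) s ^+ dst x o / W x <= C.
Proof.
move=> s0 s1 [u0 Tu0] SW; pose j := dst o u0.
have near_o : spine_nbhd G j o.
  by exists u0 => //; apply: dist_ball => //; exact: SV.
(* Any [a < s] with [q * a * s < 1] would do. *)
pose a := s / 2 / q%:R; have qp : 0 < q%:R :> R by rewrite ltr0n.
have a0 : 0 < a by rewrite divr_gt0 // divr_gt0.
have a_s : a < s.
  by rewrite ltr_pdivrMr //; have := ler_peMr (ltW s0) q1; lra.
have qas : q%:R * (a * s) < 1.
  have -> : q%:R * (a * s) = s * s / 2.
    by rewrite mulrA [q%:R * a]mulrC divfK ?gt_eqF // mulrAC.
  rewrite ltr_pdivrMr // mul1r; apply: (@le_lt_trans _ _ 1); last by rewrite ltr1n.
  by rewrite mulr_ile1 // ltW.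
have [C C0 CP] := green_sum Gtree Gdeg dq q0 a0 a_s qas.
pose B := C / a ^+ j; have B0 : 0 < B by rewrite divr_gt0 // exprn_gt0.
have [fin _] := ctyp s0.
(* [p] sends a vertex of the neighbourhood to a nearby vertex of the spine. *)
have BW x X : V x -> uniq X -> (forall y, y \in X -> V y /\ spine_nbhd G j y) ->
    \sum_(y <- X) s ^+ dst x y <= B * W x.
  move=> Vx uX XS.
  have /boolp.choice[p pP] y : exists u, y \in X -> T' u /\ gball G y j u.
    have [/XS[_ [u Tu yu]]|nyX] := boolP (y \in X); first by exists u.
    by exists 0%N.
  pose Y := undup (map p X).
  have YT u : u \in Y -> T' u.
    by rewrite mem_undup => /mapP[y /pP[Tp _] ->].
  rewrite /B mulrAC ler_pdivlMr ?exprn_gt0 // mulr_suml.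
  apply: (@le_trans _ _ (\sum_(y <- X) \sum_(u <- Y) a ^+ dst u y * s ^+ dst y x)).
    rewrite big_seq [leRHS]big_seq; apply: ler_sum => y yX.
    have [Vy _] := XS _ yX; have [Tp yp] := pP _ yX; have Vp := SV Tp.
    have pY : p y \in Y by rewrite mem_undup map_f.
    rewrite (bigD1_seq (p y)) ?undup_uniq //= -[leLHS]addr0; apply: lerD.
      rewrite mulrC (distC Gconn Vy Vx); apply: ler_wpM2r.
        by rewrite exprn_ge0 // ltW.
      apply: ler_wiXn2l; [exact: ltW|exact/ltW/(lt_le_trans a_s)|].
      by rewrite (distC Gconn Vp Vy); exact: gball_distW.
    by apply: sumr_ge0 => u _; rewrite mulr_ge0 // exprn_ge0 // ltW.
  rewrite exchange_big /=.
  apply: (@le_trans _ _ (\sum_(u <- Y) C * s ^+ dst x u)).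
    rewrite big_seq [leRHS]big_seq; apply: ler_sum => u /YT/SV Vu.
    rewrite (distC Gconn Vx Vu); apply: CP => // y yX.
    by have [] := XS _ yX.
  rewrite -mulr_sumr; apply: ler_wpM2l; first exact: ltW.
  by apply: SW => //; exact: undup_uniq.
have [C' C'P] := received_bound s0 (near_spine_local j)
  (S := fun _ y => spine_nbhd G j y) (W := fun x => B * W x) (fin j)
  (fun x y _ _ => near_spine_limit Gtree Gdeg j x y) BW.
exists (C' * B) => X uX XV; rewrite -ler_pdivrMr // mulr_suml.
apply: le_trans (C'P X uX (fun x xX => conj (XV x xX) near_o)).
by apply: ler_sum => x _; rewrite -mulrA -invfM [W x * B]mulrC.
Qed.

Lemma spine_sum_bounded (t : R) x : 0 < t -> t <= 1 -> V x ->
  (forall u, T' u -> exp_summable (spine G) t u) ->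
  exists M : R, forall Y, uniq Y -> (forall u, u \in Y -> T' u) ->
    \sum_(u <- Y) t ^+ dst x u <= M.
Proof.
move=> t0 t1 Vx sumT; have [T0|noT] := pselect (T' !=set0); last first.
  exists 0 => -[|u Y] _ YT; first by rewrite big_nil.
  by case: noT; exists u; apply: YT; exact: mem_head.
have [p Tp dp] := spine_projection Gtree Gdeg Vx T0.
have [M MP] := sumT p Tp; exists M => Y uY YT; apply: le_trans (MP Y uY YT).
rewrite big_seq [leRHS]big_seq; apply: ler_sum => u /YT Tu.
rewrite (dist_spine Gtree Gdeg Tp Tu) dp //.
by apply: ler_wiXn2l; rewrite ?(ltW t0) // leq_addl.
Qed.

(** Serves to replace an infinite sum of nonnegative terms by a real number that bounds
    the finite partial sums and is reached by one of them up to a factor 2. *)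
Lemma half_sup (A : set R) a0 M : A a0 -> 0 < a0 -> (forall a, A a -> a <= M) ->
  exists W, [/\ 0 < W, forall a, A a -> a <= W & exists2 a, A a & W <= 2 * a].
Proof.
move=> Aa0 a00 AM; have supA : has_sup A by split; [exists a0|exists M => a /AM].
have le_sup a : A a -> a <= sup A by move=> Aa; apply: ub_le_sup => //; case: supA.
have W0 : 0 < sup A by apply: lt_le_trans a00 (le_sup _ Aa0).
exists (sup A); split=> //.
have [a Aa aW] := sup_adherent (divr_gt0 W0 (ltr0n R 2)) supA.
by exists a => //; move: aW; lra.
Qed.

(** With [W x] the sum of [t ^+ d x u] over the spine, [spine_received] bounds
    the sum of [s ^+ d x o / W x] while [green_sum] bounds that of
    [s ^+ d x o * W x]; and [1 <= W^-1 + W]. *)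
Lemma summable_of_spine (r : rat) (t : R) (s := ratr r : R) :
  0 < s -> s < t -> t < 1 -> q%:R * (s * t) < 1 -> T' !=set0 ->
  (forall u, T' u -> exp_summable (spine G) t u) -> exp_summable G s o.
Proof.
move=> s0 st t1 qst T0 sumT; have t0 : 0 < t by exact: lt_trans st.
have [u0 Tu0] := T0.
pose A x := [set a | exists2 Y, uniq Y /\ (forall u, u \in Y -> T' u) &
  a = \sum_(u <- Y) t ^+ dst x u].
have /boolp.choice[W WP] x : exists W, V x ->
    [/\ 0 < W, forall a, A x a -> a <= W & exists2 a, A x a & W <= 2 * a].
  have [Vx|nVx] := pselect (V x); last by exists 0.
  have [M MP] := spine_sum_bounded t0 (ltW t1) Vx sumT.
  have [|||W WP] := @half_sup (A x) (t ^+ dst x u0) M; last by exists W.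
  - exists [:: u0]; rewrite ?big_seq1 //; split=> // u.
    by rewrite inE => /eqP ->.
  - exact: exprn_gt0.
  - by move=> a [Y [uY YT] ->]; exact: MP.
have [|C1 C1P] := spine_received (W := W) s0 (ltW (lt_trans st t1)) T0.
  move=> x Y Vx uY YT; have [_ WA _] := WP x Vx.
  apply: le_trans (WA (\sum_(u <- Y) t ^+ dst x u) _); last by exists Y.
  apply: ler_sum => u _; apply: lerXn2r; rewrite ?nnegrE; exact: ltW.
have [C C0 CP] := green_sum Gtree Gdeg dq q0 s0 st qst.
exists (C1 + 2 * (C * W o)) => X uX XV.
apply: (@le_trans _ _ (\sum_(x <- X) (s ^+ dst x o / W x + s ^+ dst o x * W x))).
  rewrite big_seq [leRHS]big_seq; apply: ler_sum => x /XV Vx.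
  have [W0 _ _] := WP x Vx; rewrite (distC Gconn Vx Vo) -mulrDr.
  apply: ler_peMr; first by rewrite exprn_ge0 // ltW.
  have [W1|W1] := leP 1 (W x); first by rewrite ler_wpDl // invr_ge0 ltW.
  by rewrite ler_wpDr ?(ltW W0) // invf_ge1 // ltW.
rewrite big_split /=; apply: lerD; first exact: C1P.
have /boolp.choice[Y YP] x : exists Y, V x ->
    [/\ uniq Y, forall u, u \in Y -> T' u & W x <= 2 * \sum_(u <- Y) t ^+ dst x u].
  have [Vx|nVx] := pselect (V x); last by exists [::].
  by have [_ _ [_ [Y [uY YT] ->]]] := WP x Vx; exists Y.
pose Z := undup (flatten (map Y X)).
have ZT u : u \in Z -> T' u.
  by rewrite mem_undup => /flatten_mapP[x /XV Vx]; have [_ + _] := YP x Vx; apply.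
apply: (@le_trans _ _ (\sum_(x <- X) 2 * \sum_(u <- Z) s ^+ dst o x * t ^+ dst x u)).
  rewrite big_seq [leRHS]big_seq; apply: ler_sum => x xX.
  have [uY YT YW] := YP x (XV x xX).
  rewrite -mulr_sumr mulrCA; apply: ler_wpM2l; first by rewrite exprn_ge0 // ltW.
  apply: le_trans YW _; apply: ler_wpM2l => //.
  apply: ler_sum_subseq => //; first exact: undup_uniq.
    by move=> u uYx; rewrite mem_undup; apply/flatten_mapP; exists x.
  by move=> u _; rewrite exprn_ge0 // ltW.
rewrite -mulr_sumr; apply: ler_wpM2l => //; rewrite exchange_big /=.
apply: (@le_trans _ _ (\sum_(u <- Z) C * t ^+ dst o u)).
  by rewrite big_seq [leRHS]big_seq; apply: ler_sum => u /ZT/SV Vu; exact: CP.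
rewrite -mulr_sumr; apply: ler_wpM2l; first exact: ltW.
have [_ + _] := WP _ Vo; apply; exists Z => //; split=> //; exact: undup_uniq.
Qed.

(** If the tree is infinite, finitely many vertices that are not farther than
    [x] from the end are not farther than [x] from some vertex [z] either;
    [green_sum] towards [z] then bounds their total weight by a constant. *)
Lemma summable_of_empty_spine (r : rat) (t : R) (s := ratr r : R) :
  0 < s -> s < t -> t < 1 -> q%:R * (s * t) < 1 -> ~ (T' !=set0) ->
  exp_summable G s o.
Proof.
move=> s0 st t1 qst noT; have t0 : 0 < t by exact: lt_trans st.
have s1 : s < 1 by exact: lt_trans t1.
have [Vfin|Voo] := pselect (finite_set V).
  exists (size (enum_set V))%:R => X uX XV.
  apply: (@le_trans _ _ (size X)%:R); last first.
    by rewrite ler_nat uniq_leq_size // => y /XV Vy; apply/(mem_enum_set y Vfin).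
  rewrite -sum1_size natr_sum; apply: ler_sum => y _; apply: exprn_ile1; exact: ltW.
have [C C0 CP] := green_sum Gtree Gdeg dq q0 s0 st qst.
have nfC x X : V x -> uniq X -> (forall y, y \in X -> V y /\ not_farther G x y) ->
    \sum_(y <- X) s ^+ dst x y <= C.
  move=> Vx uX XS.
  have /boolp.choice[N NP] y : exists N, y \in X ->
      forall z, V z -> (N <= dst x z)%N -> (dst y z <= dst x z)%N.
    have [/XS[_ [N NP]]|nyX] := boolP (y \in X); first by exists N.
    by exists 0%N.
  have [z Vz xz] := exists_dist Gtree Gdeg Voo (\max_(y <- X) N y) Vx.
  have tz0 : 0 < t ^+ dst x z by rewrite exprn_gt0.
  rewrite -(ler_pM2r tz0).
  have XV y : y \in X -> V y by move=> /XS[].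
  apply: le_trans (CP x z X Vx Vz uX XV).
  rewrite mulr_suml big_seq [leRHS]big_seq; apply: ler_sum => y yX.
  apply: ler_wpM2l; first by rewrite exprn_ge0 // ltW.
  apply: ler_wiXn2l; [exact: ltW|exact: ltW|apply: NP => //].
  by rewrite xz; exact: leq_bigmax_seq.
have [_ fin] := ctyp s0.
have [C' C'P] := received_bound s0 level_local (S := not_farther G)
  (W := fun=> C) fin (fun x y => @level_limit G d Gtree Gdeg noT Voo x y) nfC.
exists (C + C' * C) => X uX XV.
rewrite (bigID (fun x => `[< not_farther G o x >])) /=; apply: lerD.
  rewrite -big_filter; apply: nfC => //; first exact: filter_uniq.
  by move=> y; rewrite mem_filter => /andP[/asboolP oy /XV].
rewrite -big_filter -ler_pdivrMr // mulr_suml.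
apply: le_trans (C'P [seq x <- X | ~~ `[< not_farther G o x >]] _ _).
- rewrite big_seq [leRHS]big_seq; apply: ler_sum => x.
  by rewrite mem_filter => /andP[_ /XV Vx]; rewrite (distC Gconn Vo Vx).
- exact: filter_uniq.
- move=> x; rewrite mem_filter => /andP[/asboolP nox /XV Vx]; split=> //.
  by have [] := not_farther_total Gtree Gdeg noT Vo Vx.
Qed.

End Typical.

(** * Growth of a tree and of its spine *)

Section RegularTreeSum.
Context {R : realType}.
Local Open Scope ring_scope.

Lemma bounded_powers (x C : R) : (forall n, x ^+ n <= C) -> x <= 1.
Proof.
move=> xC; rewrite leNgt; apply/negP => x1.
have x0 : 0 < x - 1 by rewrite subr_gt0.
have := xC (Num.trunc (C / (x - 1))).+1; apply/negP; rewrite -ltNge.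
apply: (@lt_le_trans _ _ ((Num.trunc (C / (x - 1))).+1%:R * (x - 1))).
  by rewrite -ltr_pdivrMr //; exact: truncnS_gt.
have := bernoulli_le (Num.trunc (C / (x - 1))).+1 (ltW x0).
rewrite (_ : 1 + (x - 1) = x); last by rewrite addrC subrK.
by apply: le_trans; rewrite lerDr.
Qed.

(** Since spheres have at least [(k - 1) ^ n] elements, summability at [s'] forces
    [(k - 1) * s' <= 1]; conversely [(k - 1) * s < 1] bounds the sums at [s]
    around all vertices at once, because spheres have at most [2 * q ^ n]
    elements. *)
Lemma regular_tree_sum (H : graph) k o (s s' : R) : is_tree H ->
  (forall x, vert H x -> ([set y | adj H x y] #= `I_k)%card) -> vert H o ->
  0 < s -> s < s' -> s' <= 1 -> exp_summable H s' o ->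
  exists W : R, forall x Y, vert H x -> uniq Y -> (forall u, u \in Y -> vert H u) ->
    \sum_(u <- Y) s ^+ dist H x u <= W.
Proof.
move=> Htree Hk Vo s0 ss' s'1 [C CP]; have Hconn := Htree.1.
have Hdeg : degree_le k H by move=> x /Hk; rewrite card_eq_le => /andP[].
have s'0 : 0 < s' by exact: lt_trans ss'.
have ks' : k.-1%:R * s' <= 1.
  apply: (@bounded_powers _ C) => n.
  have mem := mem_sphere Hconn Hdeg n _ Vo.
  apply: le_trans (CP (enum_set (sphere H o n)) _ _); last 2 first.
  - exact: enum_set_uniq.
  - by move=> y /mem[].
  rewrite (eq_big_seq (fun=> s' ^+ n)); last by move=> y /mem[_ ->].
  rewrite big_const_seq iter_addr_0 count_predT -[leRHS]mulr_natl exprMn.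
  apply: ler_wpM2r; first by rewrite exprn_ge0 // ltW.
  by rewrite -natrX ler_nat; exact: size_sphere_regular.
(* The maximum with 1 covers [k <= 1], where [s < 1] gives the bound. *)
pose q := maxn k.-1 1.
have qs : q%:R * s < 1.
  rewrite /q /maxn; case: ifP => _; first by rewrite mul1r; exact: lt_le_trans s'1.
  have [->|k1] := posnP k.-1; first by rewrite mul0r.
  by apply: lt_le_trans ks'; rewrite ltr_pM2l // ltr0n.
exists (2 * (1 - q%:R * s)^-1) => x Y Vx uY YV.
by apply: (ball_sum Hconn Hdeg) => //; rewrite ?ltW // /q; lia.
Qed.

End RegularTreeSum.

Section Deterministic.
Context {R : realType} (d : nat).
Hypothesis hd : (2 <= d)%N.
Variable c : rooted_graph d.
Local Notation G := (base_graph (rep c)).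
Hypothesis Gtree : is_tree G.
Hypothesis ctyp : typical (R := R) c.

Let Gconn : connected_graph G. Proof. exact: (@base_connected _ _ (rep c)). Qed.
Let Gdeg : degree_le d G. Proof. exact: (@base_degree _ _ (rep c)). Qed.
Let o := val (Defs.root (rep c)).
Let Vo : vert G o. Proof. exact: set_valP. Qed.
Let G0 : vert G !=set0. Proof. by exists o. Qed.
Let Sconn : connected_graph (spine G). Proof. exact: spine_connected Gtree Gdeg. Qed.
Let dq : (d <= d.-1.+1)%N. Proof. lia. Qed.
Let q0 : (0 < d.-1)%N. Proof. lia. Qed.

Lemma spine_degree_le : degree_le d (spine G).
Proof.
move=> x [Vx _]; apply: card_le_trans (Gdeg Vx); apply: subset_card_le.
by move=> y /(adj_spineP Gtree Gdeg)[].
Qed.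

Let growth_le_root (s e : R) : (0 < s)%R -> (s < 1)%R -> (s^-1 < e)%R ->
  exp_summable G s o -> growth R G <= e%:E.
Proof.
move=> s0 s1 se sum; apply: (growth_le Gconn Gdeg s0 (ltW s1) se) => o' Vo'.
exact: (exp_summable_shift Gconn Vo Vo' s0 (ltW s1)).
Qed.

Lemma growth_spine_le : growth R (spine G) <= growth R G.
Proof.
rewrite leNgt; apply/negP => /(rational_parameter_between (growth_ge1 Gdeg G0)).
move=> [r [t [e [s0 st t1 Gt [se eS]]]]].
set s := ratr r in s0 st se; have s1 : (s < 1)%R := lt_trans st t1.
move: eS; apply/negP; rewrite -leNgt.
apply: (growth_le Sconn spine_degree_le s0 (ltW s1) se) => u Tu.
have Vu := vert_spine_vert Tu.
have [C CP] := growth_summable Gconn Gdeg Vu s0 st (ltW s1) Gt.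
exists C => X uX XT; rewrite (eq_big_seq (fun y => s ^+ dist G u y)%R); last first.
  by move=> y /XT Ty; rewrite (dist_spine Gtree Gdeg).
by apply: CP => // y /XT/vert_spine_vert.
Qed.

Lemma growth_le_max :
  growth R G <= maxe ((d%:R - 1)%R `^ 2^-1)%R%:E (growth R (spine G)).
Proof.
set m : R := ((d%:R - 1) `^ 2^-1)%R.
have d1 : (d%:R - 1 = d.-1%:R :> R)%R by rewrite -subn1 natrB //; lia.
have m2 : (m ^+ 2 = d.-1%:R)%R by rewrite /m root_expr // d1.
have m1 : (1 <= m)%R.
  by rewrite -(@ler_pXn2r _ 2) ?nnegrE ?powR_ge0 // expr1n m2 ler1n.
have max1 : 1%:E <= maxe m%:E (growth R (spine G)) by rewrite le_max lee_fin m1.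
rewrite leNgt; apply/negP => /(rational_parameter_between max1).
move=> [r [t [e [s0 st t1 Gt [se eG]]]]].
set s := ratr r in s0 st se; have s1 : (s < 1)%R := lt_trans st t1.
move: eG; apply/negP; rewrite -leNgt; apply: (growth_le_root s0 s1 se).
have t0 : (0 < t)%R := lt_trans s0 st.
move: Gt; rewrite gt_max lte_fin => /andP[mt St].
have mt1 : (m * t < 1)%R by rewrite -ltr_pdivlMr // mul1r.
pose t' := ((s + t) / 2)%R; have [st' t't] : (s < t' /\ t' < t)%R by rewrite /t'; lra.
have qst : (d.-1%:R * (s * t') < 1)%R.
  rewrite -m2; apply: (@le_lt_trans _ _ ((m * t) ^+ 2)%R).
    rewrite exprMn; apply: ler_wpM2l; first by rewrite exprn_ge0 // powR_ge0.
    by rewrite expr2; apply: ler_pM; lra.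
  by rewrite exprn_ilt1 // mulr_ge0 ?powR_ge0 // ltW.
have [T0|noT] := pselect (vert (spine G) !=set0); last first.
  exact: (summable_of_empty_spine ctyp Gtree dq q0 s0 st' (lt_trans t't t1) qst noT).
apply: (summable_of_spine ctyp Gtree dq q0 s0 st' (lt_trans t't t1) qst T0) => u Tu.
apply: (growth_summable Sconn spine_degree_le Tu _ t't _ St); first exact: lt_trans st'.
exact/ltW/(lt_trans t't).
Qed.

Lemma growth_regular_spine : vert (spine G) !=set0 -> is_tree (spine G) ->
  regular_graph (spine G) -> growth R G <= growth R (spine G).
Proof.
move=> T0 Stree [k Sk].
have S1 : 1%:E <= growth R (spine G) := growth_ge1 spine_degree_le T0.
rewrite leNgt; apply/negP => /(rational_parameter_between S1).
move=> [r [t [e [s0 st t1 St [se eG]]]]].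
set s := ratr r in s0 st se; have s1 : (s < 1)%R := lt_trans st t1.
move: eG; apply/negP; rewrite -leNgt; apply: (growth_le_root s0 s1 se).
pose t' := ((s + t) / 2)%R; have [st' t't] : (s < t' /\ t' < t)%R by rewrite /t'; lra.
have t'1 : (t' < 1)%R := lt_trans t't t1.
have [u0 Tu0] := T0.
have sum' := growth_summable Sconn spine_degree_le Tu0 (lt_trans s0 st') t't (ltW t'1) St.
have [W WP] := regular_tree_sum Stree Sk Tu0 s0 st' (ltW t'1) sum'.
have WG x Y : vert G x -> uniq Y -> (forall u, u \in Y -> vert (spine G) u) ->
    (\sum_(u <- Y) s ^+ dist G x u <= W)%R.
  move=> Vx uY YT; have [p Tp dp] := spine_projection Gtree Gdeg Vx T0.
  apply: le_trans (WP p Y Tp uY YT).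
  rewrite big_seq [leRHS]big_seq; apply: ler_sum => u /YT Tu.
  rewrite (dist_spine Gtree Gdeg Tp Tu) dp //.
  by apply: ler_wiXn2l; rewrite ?(ltW s0) ?(ltW s1) // leq_addl.
have W0 : (0 < W)%R.
  apply: lt_le_trans (WG u0 [:: u0] _ _ _) => //; last first.
  - by move=> u; rewrite inE => /eqP ->.
  - exact: vert_spine_vert.
  by rewrite big_seq1 exprn_gt0.
have [C CP] := spine_received ctyp Gtree dq q0 s0 (ltW s1) T0 WG.
exists (C * W)%R => X uX XV; rewrite -ler_pdivrMr // mulr_suml.
apply: le_trans (CP X uX XV); rewrite big_seq [leRHS]big_seq.
by apply: ler_sum => x /XV Vx; rewrite (distC Gconn Vo Vx).
Qed.

End Deterministic.

Lemma ae_forall_countable (R : realType) disp (Omega : measurableType disp)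
    (mu : {measure set Omega -> \bar R}) (I : countType) (A : I -> Omega -> Prop) :
  (forall i, {ae mu, forall w, A i w}) -> {ae mu, forall w i, A i w}.
Proof.
move=> aeA; have : {ae mu, forall w, forall n i, @choice.unpickle I n = Some i -> A i w}.
  apply: ae_foralln => n; case: (@choice.unpickle I n) => [i|]; last exact: aeW.
  by apply: filterS (aeA i) => w Aiw _ [<-].
by apply: filterS => w h i; apply: (h (choice.pickle i)); exact: choice.pickleK.
Qed.

Lemma ae_typical (R : realType) (d : nat) (disp : measure_display)
    (Omega : measurableType disp) (P : probability Omega R)
    (T : {RV P >-> rooted_graph d}) :
  unimodular T -> {ae P, forall w, typical (R := R) (T w)}.
Proof.
move=> Tunimod.
have near : {ae P, forall w (i : rat * nat), (0 < ratr i.1 :> R)%R ->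
    received_liminf (near_spine i.2) (ratr i.1 : R) (T w) < +oo}.
  apply: ae_forall_countable => -[r j] /=.
  have [r0|r0] := ltP 0%R (ratr r : R); last by apply: aeW => w.
  have := ae_received_liminf Tunimod r0 (near_spine_local j).
  by apply: filterS => w h _.
have lev : {ae P, forall w (r : rat), (0 < ratr r :> R)%R ->
    received_liminf level (ratr r : R) (T w) < +oo}.
  apply: ae_forall_countable => r.
  have [r0|r0] := ltP 0%R (ratr r : R); last by apply: aeW => w.
  have := ae_received_liminf Tunimod r0 level_local.
  by apply: filterS => w h _.
by apply: filterS2 near lev => w h1 h2 r r0; split=> [j|]; [exact: (h1 (r, j))|exact: h2].
Qed.

Theorem theorem4p1 (R : realType) (d : nat) (hd : (2 <= d)%N)
    (disp : measure_display) (Omega : measurableType disp)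
    (P : probability Omega R) (T : {RV P >-> rooted_graph d})
    (Tunimod : unimodular T)
    (Ttree : {ae P, forall w, is_tree (rep (T w))}) :
  [/\ {ae P, forall w, [/\ vert (spine (rep (T w))) !=set0,
                           is_tree (spine (rep (T w)))
                         & regular_graph (spine (rep (T w)))]} ->
      {ae P, forall w, growth R (rep (T w)) = growth R (spine (rep (T w)))},
      {ae P, forall w, growth R (rep (T w)) <=
         maxe ((d%:R - 1)%R `^ 2^-1)%R%:E (growth R (spine (rep (T w))))}
    & {ae P, forall w, ((d%:R - 1)%R `^ 2^-1)%R%:E < growth R (rep (T w))} ->
      {ae P, forall w, growth R (rep (T w)) = growth R (spine (rep (T w)))}].
Proof.
have Ttyp := ae_typical Tunimod.
have le_max : {ae P, forall w, growth R (rep (T w)) <=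
    maxe ((d%:R - 1)%R `^ 2^-1)%R%:E (growth R (spine (rep (T w))))}.
  by apply: filterS2 Ttree Ttyp => w tree typ; exact: growth_le_max.
split=> // [reg|big].
- apply: filterS3 Ttree Ttyp reg => w tree typ [T0 Stree Sreg].
  apply/eqP; rewrite eq_le growth_spine_le // andbT.
  exact: growth_regular_spine.
- apply: filterS3 Ttree le_max big => w tree wmax wbig.
  apply/eqP; rewrite eq_le growth_spine_le // andbT.
  by move: wmax; rewrite le_max leNgt wbig.
Qed.
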